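(* Fix $0<\lambda<1/2$ and $0<\vartheta<1$. There exist a $C^\infty$ $\lambda$-pseudo-affine IFS $\Phi=\{f_0,f_1\}$ on $[0,1]$ and a $C^\infty$ diffeomorphism $h:[0,1]\to[0,1]$, conjugating $\Phi_\lambda$ to $\Phi$ on their attractors, such that $h'\equiv\eta$ on $X_{\Phi_\lambda}$ for some $\eta>0$. Moreover, the uniform stationary measure $\nu=h_*\mu_\lambda$ of $\Phi$ satisfies, for some constants $c,C>0$, $$\bigl|\widehat\nu(\xi)\bigr|\le C\exp\left(-c\bigl(\log(2+|\xi|)\bigr)^\vartheta\right),\qquad \xi\in\mathbb R.$$
   Context: IFSs here consist of two smooth maps $f_0,f_1:[0,1]\to[0,1]$ and are assumed hyperbolic: $0<f_i'(x)<1$ for all $x\in[0,1]$, $i=0,1$, and $0=f_0(0)<f_0(1)<f_1(0)<f_1(1)=1$. The attractor $X_\Phi$ is the unique nonempty compact set with $X_\Phi=f_0(X_\Phi)\cup f_1(X_\Phi)$. $\Phi$ is $\lambda$-pseudo-affine if $f_i'(x)=\lambda$ for every $x\in X_\Phi$ and $i=0,1$. $\Phi_\lambda=\{e_0,e_1\}$ with $e_0(x)=\lambda x$, $e_1(x)=\lambda x+1-\lambda$. A diffeomorphism $h:[0,1]\to[0,1]$ conjugates $\Phi_\lambda$ to $\Phi$ on their attractors if $h(e_i(x))=f_i(h(x))$ for every $x\in X_{\Phi_\lambda}$, $i=0,1$. The uniform stationary measure of $\Phi=\{f_0,f_1\}$ is the unique Borel probability measure $\mu$ with $\mu=\frac12(f_0)_*\mu+\frac12(f_1)_*\mu$;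 $\mu_\lambda$ is the uniform stationary measure of $\Phi_\lambda$. The Fourier transform is $\widehat\nu(\xi)=\int e^{-2\pi i\xi t}\,d\nu(t)$. *)

(* Defs.v *)
From HB Require Import structures.
From mathcomp Require Import all_boot all_order all_algebra.
From mathcomp Require Import all_classical all_reals all_analysis.
From mathcomp Require Import complex.

Set Implicit Arguments.
Unset Strict Implicit.
Unset Printing Implicit Defensive.

Import Order.TTheory GRing.Theory Num.Theory.
Import numFieldNormedType.Exports.

Local Open Scope classical_set_scope.
Local Open Scope ring_scope.

(* A map of [0, 1] is represented by a function R -> R whose values outside
   [0, 1] are irrelevant: every definition below only uses its values at points
   of [0, 1]. *)

Definition maps01 (R : realType) (f : R -> R) : Prop :=
  forall x : R, x \in `[0, 1] -> f x \in `[0, 1].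

Definition quot_to (R : realType) (f : R -> R) (x : R) : set_system R :=
  (fun y => (f y - f x) / (y - x)) @ within `[0, 1]%classic (x^').

(* Derivative relative to [0, 1]; one-sided at 0 and at 1. *)
Definition D01 (R : realType) (f : R -> R) (x : R) : R := lim (quot_to f x).

Definition smooth01 (R : realType) (f : R -> R) : Prop :=
  forall (n : nat) (x : R), x \in `[0, 1] -> cvg (quot_to (iter n (@D01 R) f) x).

Definition smooth_diffeo01 (R : realType) (h : R -> R) : Prop :=
  [/\ maps01 h, smooth01 h &
      exists g : R -> R,
        [/\ maps01 g, smooth01 g,
            forall x, x \in `[0, 1] -> g (h x) = x &
            forall x, x \in `[0, 1] -> h (g x) = x]].

Definition hyperbolic_ifs (R : realType) (f0 f1 : R -> R) : Prop :=
  [/\ maps01 f0 /\ maps01 f1,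
      smooth01 f0 /\ smooth01 f1,
      forall x, x \in `[0, 1] -> 0 < D01 f0 x < 1 /\ 0 < D01 f1 x < 1,
      f0 0 = 0 /\ f1 1 = 1 &
      [/\ f0 0 < f0 1, f0 1 < f1 0 & f1 0 < f1 1]].

Definition self_similar (R : realType) (f0 f1 : R -> R) (X : set R) : Prop :=
  [/\ X `<=` `[0, 1]%classic, X !=set0, compact X &
      X = f0 @` X `|` f1 @` X].

Definition is_attractor (R : realType) (f0 f1 : R -> R) (X : set R) : Prop :=
  self_similar f0 f1 X /\ forall Y, self_similar f0 f1 Y -> Y = X.

Definition pseudo_affine (R : realType) (lam : R) (f0 f1 : R -> R) : Prop :=
  hyperbolic_ifs f0 f1 /\
  exists X, is_attractor f0 f1 X /\
    forall x, X x -> D01 f0 x = lam /\ D01 f1 x = lam.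

Definition aff0 (R : realType) (lam x : R) : R := lam * x.
Definition aff1 (R : realType) (lam x : R) : R := lam * x + 1 - lam.

(* Push-forward by a map of [0, 1], for a measure carried by [0, 1]. *)
Definition push01 (R : realType) (f : R -> R) (mu : set R -> \bar R)
    (A : set R) : \bar R :=
  mu (`[0, 1]%classic `&` f @^-1` A).

(* Borel probability measures on [0, 1] are the Borel probability measures on R
   giving mass 1 to [0, 1]. *)
Definition stationary (R : realType) (f0 f1 : R -> R)
    (mu : probability (measurableTypeR R) R) : Prop :=
  mu `[0, 1]%classic = 1%E /\
  forall A : set (measurableTypeR R), measurable A ->
    (mu A = (2^-1)%:E * push01 f0 mu A + (2^-1)%:E * push01 f1 mu A)%E.

Definition is_uniform_stationary (R : realType) (f0 f1 : R -> R)
    (mu : probability (measurableTypeR R) R) : Prop :=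
  stationary f0 f1 mu /\
  forall mu', stationary f0 f1 mu' ->
    forall A : set (measurableTypeR R), measurable A -> mu' A = mu A.

(* The integral of exp(- 2 pi i xi t), split into real and imaginary parts. *)
Definition fourier (R : realType) (nu : probability (measurableTypeR R) R)
    (xi : R) : R[i] :=
  Complex (Rintegral nu setT (fun t => cos (- (2 * pi * xi * t))))
          (Rintegral nu setT (fun t => sin (- (2 * pi * xi * t)))).

(* Main.v *)
(* The conjugacy is an affine normalization of G(x) = x + sum_n a_n Q_n(x), where
   Q_n is a smooth function equal to a constant q_n(w) in [0, 1] on each of the
   2^n cylinders I_w of level n of the Cantor set.  Here a_n = delta 4^n / T_n
   with T_n = exp(n^(1/theta)); the a_n decay faster than any geometric sequence,
   so G is smooth with G' = 1 on the attractor, and for delta small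
   f_i = h o e_i o h^-1 is a contraction of [0, 1].

   Let S_n(w) be the exponential sum of frequency w over the values of the
   truncation of G at the left ends of the cylinders of level n, normalized by
   2^-n.  If the values q_n are drawn independently and uniformly from a fine
   grid of [0, 1], then E S_n(w) is bounded by the sup over phases of |S_(n-1)(w)|,
   and is O(1 / (w a_n)) in any case; by an exponential moment estimate and a
   union bound over a net of the frequencies w <= T_(n+1), some choice of q_n
   makes |S_n - E S_n| = O((3/4)^n) for all of them at once.  Hence for
   T_n <= w <= T_(n+1) one has |S_j(w)| = O((3/4)^n) for all j >= n, and letting j
   tend to infinity bounds the Fourier transform of nu at w; n is comparable to
   (log w)^theta.

   The estimates are carried out with cos(x + phi), for all phases phi, in place
   of complex exponentials. *)

Require Import Defs.
From HB Require Import structures.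
From mathcomp Require Import all_boot all_order all_algebra.
From mathcomp Require Import all_classical all_reals all_analysis.
From mathcomp Require Import measurable_realfun complex.
From mathcomp Require Import ring lra.

Set Implicit Arguments.
Unset Strict Implicit.
Unset Printing Implicit Defensive.

Import Order.TTheory GRing.Theory Num.Theory.
Import numFieldNormedType.Exports.

Local Open Scope classical_set_scope.
Local Open Scope ring_scope.

(** * Smooth functions on the line *)

(** Keeping h' constant on the attractor is the rigid constraint: a perturbation may move cylinders
    but must have zero derivative at the attractor, whence functions that are locally constant on
    cylinders. Two demands on a_n compete. The j-th derivative of the level-n term has size about
    a_n lam^(-jn), which calls for superexponential decay; yet w a_n has to be large already at w =
    T_n. With log T_n = n^(1/theta) both hold: theta < 1 makes the exponent superlinear, and log T_n
    is still polynomial in n. The union bound runs over about T_(n+1) 2^n frequencies but costs only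
    the logarithm of that number, against fluctuations of size 2^(-n/2); since 1/sqrt 2 < 3/4, the
    product is O((3/4)^n). The levels are treated one at a time, earlier values being frozen into
    arbitrary base points, and each choice comes from an average over a finite set. The choice at
    level j covers every w <= T_(j+1), so it also protects the smaller frequencies settled before,
    at the price of a summable error. Phases stay arbitrary because the branching of words and the
    averaging over translations both act on a sum as phase shifts. *)

Section SmoothFunctions.
Variable R : realType.
Implicit Types (f g : R -> R) (n : nat).

(** Order [n] asks for [n] successive derivatives, without continuity of the last one; over all [n]
    this is the C^infinity class, and inductions advance one derivative at a time. *)
Fixpoint Ck n f : Prop :=
  if n is n'.+1 then (forall x : R, derivable f x 1) /\ Ck n' (derive1 f) else True.

Definition smooth f := forall n, Ck n f.

Lemma derive1_funE f g : (forall x : R, is_derive x 1 f (g x)) -> (derive1 f) = g.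
Proof. by move=> fg; apply/funext => x; rewrite derive1E derive_val. Qed.

Lemma derivable_is_derive f (x : R) : derivable f x 1 -> is_derive x 1 f ((derive1 f) x).
Proof. by move=> df; rewrite derive1E; exact: DeriveDef. Qed.

Lemma is_derive_near_eq f g (x d : R) : (\forall z \near x, f z = g z) ->
  is_derive x 1 f d -> is_derive x 1 g d.
Proof. exact: near_eq_is_derive. Qed.

Lemma Ck_is_derive n f g :
  (forall x : R, is_derive x 1 f (g x)) -> Ck n g -> Ck n.+1 f.
Proof. by move=> fg gn; split=> [x|]; [case: (fg x)|rewrite (derive1_funE fg)]. Qed.

Lemma CkW n f : Ck n.+1 f -> Ck n f.
Proof.
by elim: n f => // n IH f [df cf]; split => //; exact: IH.
Qed.

Lemma Ck_cst n (c : R) : Ck n (fun=> c).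
Proof.
elim: n c => // n IH c; exact: (@Ck_is_derive _ _ (fun=> 0)) (IH 0).
Qed.

Lemma Ck_id n : Ck n (fun x : R => x).
Proof.
case: n => // n; exact: (@Ck_is_derive _ _ (fun=> 1)) (Ck_cst n 1).
Qed.

Lemma CkD n f g : Ck n f -> Ck n g -> Ck n (fun x => f x + g x).
Proof.
elim: n f g => // n IH f g [df cf] [dg cg].
apply: (@Ck_is_derive _ _ (fun x => (derive1 f) x + (derive1 g) x)) (IH _ _ cf cg) => x.
by apply: is_deriveD; exact: derivable_is_derive.
Qed.

Lemma CkM n f g : Ck n f -> Ck n g -> Ck n (fun x => f x * g x).
Proof.
elim: n f g => // n IH f g [df cf] [dg cg].
have cfW : Ck n f by apply: CkW; split.
have cgW : Ck n g by apply: CkW; split.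
apply: (@Ck_is_derive _ _ (fun x => f x * (derive1 g) x + g x * (derive1 f) x)); last first.
  by apply: CkD; exact: IH.
move=> x; apply: is_deriveM; exact: derivable_is_derive.
Qed.

Lemma Ck_comp n f g : Ck n f -> Ck n g -> Ck n (fun x => f (g x)).
Proof.
elim: n f g => // n IH f g [df cf] [dg cg].
have cgW : Ck n g by apply: CkW; split.
apply: (@Ck_is_derive _ _ (fun x => (derive1 f) (g x) * (derive1 g) x)); last first.
  by apply: CkM => //; exact: IH.
by move=> x; apply: is_derive1_comp; exact: derivable_is_derive.
Qed.

(** The derivative of 1/f is a product of -1, two copies of 1/f and f', so order [n] of 1/f itself
    yields order [n.+1]. *)
Lemma CkV n f : (forall x, f x != 0) -> Ck n f -> Ck n (fun x => (f x)^-1).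
Proof.
move=> f0; elim: n => // n IH [df cf].
have cfW : Ck n f by apply: CkW; split.
have cV := IH cfW.
apply: (@Ck_is_derive _ _ (fun x => -1 * ((f x)^-1 * (f x)^-1) * (derive1 f) x)).
  move=> x; apply: is_derive_eq; first exact: is_deriveV (derivable_is_derive (df x)).
  by rewrite /GRing.scale /= expr2 invfM mulN1r.
by apply: CkM => //; apply: CkM; [exact: Ck_cst|exact: CkM].
Qed.

Lemma Ck_affine n (a b : R) : Ck n (fun x => a * x + b).
Proof. by apply: CkD; [apply: CkM; [exact: Ck_cst|exact: Ck_id]|exact: Ck_cst]. Qed.

Lemma smooth_family (F : nat -> R -> R) :
  (forall k (x : R), is_derive x 1 (F k) (F k.+1 x)) -> smooth (F 0%N).
Proof.
move=> dF n; suff: forall k, Ck n (F k) by [].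
by elim: n => // n IH k; exact: Ck_is_derive (dF k) (IH k.+1).
Qed.

Lemma smooth_derive1n f : smooth f -> forall n (x : R), derivable ((derive1n n f)) x 1.
Proof.
move=> sf n; elim: n f sf => [|n IH] f sf x; first by case: (sf 1%N).
by rewrite derive1Sn; apply: IH => m; case: (sf m.+1).
Qed.

Lemma derivable_continuous f (x : R) : derivable f x 1 -> {for x, continuous f}.
Proof. by move=> df; apply/differentiable_continuous/derivable1_diffP. Qed.

Lemma smooth_continuous f : smooth f -> continuous f.
Proof. by move=> sf x; apply: derivable_continuous; case: (sf 1%N). Qed.

(** Bootstrapping on g' = 1/(f' o g): order [n] of g gives order [n] of the right-hand side, hence
    order [n.+1] of g. *)
Lemma Ck_inverse f g : cancel f g -> cancel g f -> smooth f ->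
  (forall x, (derive1 f) x != 0) -> smooth g.
Proof.
move=> fK gK sf f0.
have dg (y : R) : is_derive y 1 g ((derive1 f) (g y))^-1.
  rewrite -{1}(gK y); apply: is_derive_inverse => //.
  - by near=> z; exact: fK.
  - by near=> z; exact: smooth_continuous.
  - by apply: derivable_is_derive; case: (sf 1%N).
elim=> // n IH; apply: Ck_is_derive dg _; apply: CkV => //.
by apply: Ck_comp => //; case: (sf n.+1).
Unshelve. all: by end_near. Qed.

Lemma quot_to_cvg f (x : R) : derivable f x 1 -> quot_to f x --> (derive1 f) x.
Proof.
move/derivable_is_derive/is_derive1_caratheodory => [g [fE gc <-]].
apply: cvg_within_filter.
have : g y @[y --> x^'] --> g x by apply: cvg_within_filter.
apply: cvg_trans; apply: near_eq_cvg; near=> y.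
rewrite fE mulfK// subr_eq0.
by near: y; exact: nbhs_dnbhs_neq.
Unshelve. all: by end_near. Qed.

(** Each point is approached from inside the interval, to the right if it lies in the left half and
    to the left otherwise. Properness of the filter is what identifies the [lim] in [D01] with a
    limit that has been computed. *)
Lemma within01_proper (x : R) : x \in `[0, 1] ->
  ProperFilter (within `[0, 1]%classic (x^')).
Proof.
rewrite in_itv/= => /andP[x0 x1]; split; last exact: within_filter.
rewrite /within/= /dnbhs /within/= => -[e /= e0 H].
have [xlt|xge] := ltP x (1/2).
  pose y := x + Num.min (e / 2) (1/2).
  have m0 : 0 < Num.min (e / 2) (1/2 : R) by rewrite lt_min; apply/andP; split; lra.
  have m1 : Num.min (e / 2) (1/2 : R) <= 1/2 by rewrite ge_min lexx orbT.
  have m2 : Num.min (e / 2) (1/2 : R) <= e/2 by rewrite ge_min lexx.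
  apply: (H y) => /=; rewrite /y.
  - rewrite /ball/= opprD addrA subrr add0r normrN gtr0_norm//; lra.
  - by rewrite gt_eqF// ltrDl.
  - by rewrite in_itv/=; apply/andP; split; lra.
pose y := x - Num.min (e / 2) (1/2).
have m0 : 0 < Num.min (e / 2) (1/2 : R) by rewrite lt_min; apply/andP; split; lra.
have m1 : Num.min (e / 2) (1/2 : R) <= 1/2 by rewrite ge_min lexx orbT.
have m2 : Num.min (e / 2) (1/2 : R) <= e/2 by rewrite ge_min lexx.
apply: (H y) => /=; rewrite /y.
- rewrite /ball/= opprD addrA subrr add0r opprK gtr0_norm//; lra.
- by rewrite lt_eqF// ltrBlDr ltrDl.
- by rewrite in_itv/=; apply/andP; split; lra.
Qed.

Lemma D01E f (x : R) : x \in `[0, 1] -> derivable f x 1 -> D01 f x = (derive1 f) x.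
Proof.
move=> x01 df; have PF := within01_proper x01.
exact: (cvg_lim _ (quot_to_cvg df)).
Qed.

Lemma quot_to_eq f g x : x \in `[0, 1] -> {in `[0, 1], f =1 g} ->
  quot_to f x = quot_to g x.
Proof.
move=> x01 fg; rewrite /quot_to.
apply/funext => A; apply/propext; rewrite /nbhs/= /within/=.
split; apply: filterS => y /= H y01; first by rewrite -!fg//; exact: H.
by rewrite !fg//; exact: H.
Qed.

(** All maps of the construction are smooth on the whole line. For these the iterates of [D01] agree
    with the ordinary derivatives on [0, 1], and the restricted filter sees no values elsewhere. *)
Lemma smooth01_smooth f : smooth f -> smooth01 f.
Proof.
move=> sf n x x01.
have E m : {in `[0, 1], iter m (@D01 R) f =1 (derive1n m f)}.
  elim: m => // m IH y y01; rewrite iterS /D01 (quot_to_eq y01 IH).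
  by rewrite -/(D01 _ _) D01E//; exact: smooth_derive1n.
rewrite (quot_to_eq x01 (E n)); apply/cvg_ex; exists ((derive1 (derive1n n f)) x).
by apply: quot_to_cvg; exact: smooth_derive1n.
Qed.

End SmoothFunctions.

(** * A smooth bump function *)

Section FlatFunction.
Variable R : realType.
Implicit Types (p : {poly R}) (x y : R).

(** The polynomial factor in 1/x makes the family containing exp(-1/x) stable under differentiation,
    so one derivative formula for all [p] gives smoothness. *)
Definition flat p x : R := if 0 < x then p.[x^-1] * expR (- x^-1) else 0.

Lemma exprn_le_expR n y : 0 <= y -> y ^+ n <= n`!%:R * expR y.
Proof.
move=> y0; case: n => [|n]; first by rewrite expr0 fact0 mul1r -expR0 ler_expR.
have f0 : 0 < n.+1`!%:R :> R by rewrite ltr0n fact_gt0.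
rewrite mulrC -ler_pdivrMr//; apply: le_trans (expR_ge1Dxn n y0).
by rewrite lerDr.
Qed.

Lemma poly_expRN_bound p : exists2 K : R, 0 <= K &
  forall y, 0 <= y -> `|p.[y] * expR (- y)| <= K.
Proof.
exists (\sum_(i < size p) `|p`_i| * i`!%:R).
  by apply: sumr_ge0 => i _; rewrite mulr_ge0.
move=> y y0; rewrite horner_coef mulr_suml.
apply: le_trans (ler_norm_sum _ _ _) _; apply: ler_sum => i _.
rewrite -mulrA normrM ler_wpM2l// ger0_norm; last first.
  by rewrite mulr_ge0 ?exprn_ge0 ?expR_ge0.
by rewrite expRN ler_pdivrMr ?expR_gt0// exprn_le_expR.
Qed.

Lemma flat_le0 p x : x <= 0 -> flat p x = 0.
Proof. by rewrite /flat ltNge => ->. Qed.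

Lemma flat_gt0E p x : 0 < x -> flat p x = p.[x^-1] * expR (- x^-1).
Proof. by rewrite /flat => ->. Qed.

(** Trading a power of 1/x for a factor x: continuity at 0 reduces to boundedness of
    [flat (p * 'X)], and the difference quotient at 0 becomes [flat (p * 'X)] itself. *)
Lemma flatMX p x : flat p x = flat (p * 'X) x * x.
Proof.
have [x0|x0] := ltP 0 x; last by rewrite !flat_le0// mul0r.
by rewrite !flat_gt0E// hornerMX mulrAC mulfVK ?gt_eqF.
Qed.

Lemma flat_cvg0 p : flat p x @[x --> (0 : R)] --> (0 : R).
Proof.
have [K K0 HK] := poly_expRN_bound (p * 'X).
have K1 : 0 < K + 1 by rewrite ltr_pwDr.
apply/cvgr0Pnorm_lt => /= e e0.
have ek : 0 < e / (K + 1) by exact: divr_gt0.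
have := @nbhs0_lt R R^o _ ek; apply: filterS => x xe.
have [x0|x0] := ltP 0 x; last by rewrite flat_le0// normr0.
rewrite flatMX normrM (gtr0_norm x0) flat_gt0E//.
apply: le_lt_trans (ler_wpM2r (ltW x0) (HK _ _)) _; first by rewrite invr_ge0 ltW.
move: xe; rewrite (gtr0_norm x0) ltr_pdivlMr// => xe.
by apply: le_lt_trans xe; rewrite mulrC ler_pM2l// lerDl.
Qed.

Lemma is_derive_flat p x :
  is_derive x 1 (flat p) (flat ((p - p^`()) * 'X^2) x).
Proof.
have [x0|x0|->] := ltrgt0P x; last first.
(* At x = 0 the slope function is [flat (p * 'X)], which tends to 0. *)
- rewrite flat_le0//; apply/is_derive1_caratheodory.
  exists (flat (p * 'X)); split; last by rewrite flat_le0.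
  + by move=> z; rewrite [flat p 0]flat_le0// !subr0 flatMX.
  + by rewrite /prop_for /continuous_at /= [X in _ --> X]flat_le0//; exact: flat_cvg0.
- rewrite (flat_le0 _ (ltW x0)).
  apply: (@is_derive_near_eq _ (fun=> 0)) => //.
  by near=> y; rewrite flat_le0// ltW//; near: y; exact: lt_nbhsl.
apply: (@is_derive_near_eq _ (fun z => p.[z^-1] * expR (- z^-1))).
  by near=> y; rewrite flat_gt0E//; near: y; exact: lt_nbhsr.
rewrite flat_gt0E//.
have dV : is_derive x 1 (fun z : R => z^-1) (- x ^- 2 *: 1).
  by apply: is_deriveV; rewrite gt_eqF.
have dP : is_derive x 1 (fun z : R => p.[z^-1]) (p^`().[x^-1] * (- x ^- 2 *: 1)).
  exact: (is_derive1_comp (is_derive_poly p x^-1) dV).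
have dE : is_derive x 1 (fun z : R => expR (- z^-1))
    (expR (- x^-1) * (- (- x ^- 2 *: 1))).
  by apply: (is_derive1_comp (is_derive_expR _)); exact: is_deriveN.
apply: (is_derive_eq (is_deriveM dP dE)).
rewrite !hornerE /GRing.scale /=; rewrite -exprVn; ring.
Unshelve. all: by end_near. Qed.

Lemma smooth_flat p : smooth (flat p).
Proof.
move=> n; elim: n p => // n IH p.
exact: Ck_is_derive (is_derive_flat p) (IH _).
Qed.

Lemma flat1_ge0 x : 0 <= flat 1 x.
Proof. by rewrite /flat; case: ifP => // _; rewrite hornerE mul1r expR_ge0. Qed.

Lemma flat1_gt0 x : 0 < x -> 0 < flat 1 x.
Proof. by move=> x0; rewrite flat_gt0E// hornerE mul1r expR_gt0. Qed.

Lemma flat1D_gt0 x : 0 < flat 1 x + flat 1 (1 - x).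
Proof.
have [x0|x0] := ltP 0 x.
  by rewrite ltr_pwDl ?flat1_gt0 ?flat1_ge0.
by rewrite ltr_wpDl ?flat1_ge0// flat1_gt0//; lra.
Qed.

Definition smoothstep x := flat 1 x * (flat 1 x + flat 1 (1 - x))^-1.

Lemma smoothstep_le0 x : x <= 0 -> smoothstep x = 0.
Proof. by move=> x0; rewrite /smoothstep flat_le0// mul0r. Qed.

Lemma smoothstep_ge1 x : 1 <= x -> smoothstep x = 1.
Proof.
move=> x1; rewrite /smoothstep [flat _ (1 - x)]flat_le0; last by lra.
by rewrite addr0 divff// gt_eqF// flat1_gt0//; lra.
Qed.

Lemma smoothstep_01 x : 0 <= smoothstep x <= 1.
Proof.
rewrite /smoothstep ler_pdivrMr ?flat1D_gt0// mul1r lerDl flat1_ge0 andbT.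
by rewrite mulr_ge0 ?flat1_ge0// invr_ge0 ltW ?flat1D_gt0.
Qed.

Lemma Ck_smoothstep n : Ck n smoothstep.
Proof.
apply: CkM; first exact: smooth_flat.
apply: CkV => [x|]; first by rewrite gt_eqF ?flat1D_gt0.
apply: CkD; first exact: smooth_flat.
apply: (@Ck_comp _ _ _ (fun x => 1 - x)); first exact: smooth_flat.
have := Ck_affine n (-1 : R) 1; congr Ck; apply/funext => x; ring.
Qed.

End FlatFunction.

Section Bump.
Variable R : realType.
Implicit Types (f : R -> R).

Lemma derive1_at_global_max f x :
  (forall y, derivable f y 1) -> (forall y, f y <= f x) -> derive1 f x = 0.
Proof.
move=> df fx; rewrite derive1E.
have ab : x - 1 <= x + 1 by lra.
have xab : x \in `]x - 1, x + 1[ by rewrite in_itv/=; apply/andP; split; lra.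
apply: derive_val.
exact: (derive1_at_max ab (fun t _ => df t) xab (fun t _ => fx t)).
Qed.

Lemma derive1_at_global_min f x :
  (forall y, derivable f y 1) -> (forall y, f x <= f y) -> derive1 f x = 0.
Proof.
move=> df fx; rewrite derive1E.
have ab : x - 1 <= x + 1 by lra.
have xab : x \in `]x - 1, x + 1[ by rewrite in_itv/=; apply/andP; split; lra.
apply: derive_val.
exact: (derive1_at_min ab (fun t _ => df t) xab (fun t _ => fx t)).
Qed.

Lemma derive1n_locally0 f (x : R) k :
  (\forall y \near x, f y = 0) -> derive1n k f x = 0.
Proof.
move=> f0; suff H : \forall y \near x, derive1n k f y = 0.
  exact: (nbhs_singleton H).
elim: k => // k; move=> /nbhs_interior; rewrite derive1nS.
apply: filterS => y yk.
rewrite derive1E; apply: derive_val.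
have fg : \forall z \near y, cst 0 z = derive1n k f z.
  by move: yk; apply: filterS => z ->.
exact: (is_derive_near_eq fg (is_derive_cst _ _ _)).
Qed.

Lemma derive1n_bounded f (a b : R) k : a <= b -> smooth f ->
  (forall x, x <= a \/ b <= x -> f x = 0) ->
  exists2 M, 0 <= M & forall x, `|derive1n k f x| <= M.
Proof.
move=> ab sf f0.
have ck : continuous (fun x => `|derive1n k f x|).
  move=> x; apply: continuous_comp; last exact: norm_continuous.
  by apply: derivable_continuous; exact: smooth_derive1n.
have [c cab cM] := EVT_max ab (continuous_subspaceT ck).
exists `|derive1n k f c| => // x.
have [xa|ax] := ltP x a.
  rewrite derive1n_locally0 ?normr0//; near=> y; apply: f0; left.
  by apply: ltW; near: y; exact: lt_nbhsl.
have [bx|xb] := ltP b x.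
  rewrite derive1n_locally0 ?normr0//; near=> y; apply: f0; right.
  by apply: ltW; near: y; exact: lt_nbhsr.
by apply: cM; rewrite in_itv/= ax.
Unshelve. all: by end_near. Qed.

(** Used with e = 1 - 2 lam, a lower bound for the gaps between cylinders relative to their length,
    so that the rescaled bump of one cylinder vanishes on the others of its level. *)
Lemma exists_bump (e : R) : 0 < e -> exists B : R -> R,
  [/\ smooth B,
      forall x, 0 <= x <= 1 -> B x = 1,
      forall x, x <= - e \/ 1 + e <= x -> B x = 0,
      forall x, 0 <= x <= 1 \/ x <= - e \/ 1 + e <= x -> derive1 B x = 0 &
      forall k, exists2 M, 0 <= M & forall x, `|derive1n k B x| <= M].
Proof.
move=> e0.
pose B (x : R) := smoothstep ((x + e) / e) * smoothstep ((1 + e - x) / e).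
have sB : smooth B.
  move=> n; apply: CkM.
    apply: (@Ck_comp _ _ _ (fun x => (x + e) / e)); first exact: Ck_smoothstep.
    have := Ck_affine n e^-1 1; congr Ck; apply/funext => x.
    by rewrite mulrDl divff ?gt_eqF// mulrC.
  apply: (@Ck_comp _ _ _ (fun x => (1 + e - x) / e)); first exact: Ck_smoothstep.
  have := Ck_affine n (- e^-1) ((1 + e) / e); congr Ck; apply/funext => x; ring.
have B1 x : 0 <= x <= 1 -> B x = 1.
  move=> /andP[x0 x1].
  by rewrite /B !smoothstep_ge1 ?mulr1// ler_pdivlMr//; lra.
have B0 x : x <= - e \/ 1 + e <= x -> B x = 0.
  by case=> xe; rewrite /B; [rewrite smoothstep_le0 ?mul0r//|
    rewrite [X in _ * X]smoothstep_le0 ?mulr0//];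
    rewrite pmulr_lle0 ?invr_gt0//; lra.
have B01 x : 0 <= B x <= 1.
  have /andP[u0 u1] := smoothstep_01 ((x + e) / e).
  have /andP[v0 v1] := smoothstep_01 ((1 + e - x) / e).
  by rewrite mulr_ge0//= mulr_ile1.
exists B; split => // [x [x01|xe]|k].
(* As B takes values in [0, 1], a point where it equals 1 or 0 is a global extremum; this covers the
   end points of the plateau and of the support as well. *)
- apply: derive1_at_global_max => [|y]; first by case: (sB 1%N).
  by rewrite (B1 x x01); case/andP: (B01 y).
- apply: derive1_at_global_min => [|y]; first by case: (sB 1%N).
  by rewrite (B0 x xe); case/andP: (B01 y).
- by apply: (@derive1n_bounded B (- e) (1 + e)) => //; lra.
Qed.

End Bump.

(** * Termwise differentiation of series *)

Section SeriesOfFunctions.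
Variable R : realType.

Lemma MVT_between (f df : R -> R) (x y : R) :
  (forall z : R, is_derive z 1 f (df z)) ->
  exists2 c, `|c - x| <= `|y - x| & f y - f x = df c * (y - x).
Proof.
move=> fdf.
have cf : continuous f.
  by move=> z; apply: derivable_continuous; case: (fdf z).
have [xy|yx] := leP x y.
  have [c + E] := MVT_segment xy (fun z _ => fdf z) (continuous_subspaceT cf).
  rewrite in_itv/= => /andP[xc cy]; exists c => //.
  by rewrite !ger0_norm ?subr_ge0// lerB.
have [c + E] := MVT_segment (ltW yx) (fun z _ => fdf z) (continuous_subspaceT cf).
rewrite in_itv/= => /andP[yc cx]; exists c.
  by rewrite ![`|_ - x|]distrC !ger0_norm ?subr_ge0 ?(ltW yx)// lerB.
by rewrite -opprB E; ring.
Qed.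

Lemma derivative_bound_lipschitz (f df : R -> R) (K x y : R) :
  (forall z : R, is_derive z 1 f (df z)) -> (forall z, `|df z| <= K) ->
  `|f y - f x| <= K * `|y - x|.
Proof.
move=> fdf dfK; have [c _ ->] := MVT_between x y fdf.
by rewrite normrM ler_wpM2r.
Qed.

(** The mean value theorem is applied to f and then to f1; this gives the constant K instead of K /
    2. *)
Lemma taylor1_bound (f f1 f2 : R -> R) (K x y : R) :
  (forall z : R, is_derive z 1 f (f1 z)) ->
  (forall z : R, is_derive z 1 f1 (f2 z)) -> (forall z, `|f2 z| <= K) ->
  `|f y - f x - f1 x * (y - x)| <= K * (y - x) ^+ 2.
Proof.
move=> df df1 f2K; have [c cx ->] := MVT_between x y df.
rewrite -mulrBl normrM -[(y - x) ^+ 2]ger0_norm ?sqr_ge0// normrX expr2 mulrA.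
rewrite ler_wpM2r//; apply: le_trans (derivative_bound_lipschitz _ _ df1 f2K) _.
by rewrite ler_wpM2l// (le_trans _ (f2K x)).
Qed.

(** Differentiability in the form of an inequality that can be summed: quadratic remainders of the
    terms of a series add up to a quadratic remainder. *)
Lemma is_derive_quadratic (f : R -> R) (d C x : R) :
  (forall y, `|f y - f x - d * (y - x)| <= C * (y - x) ^+ 2) ->
  is_derive x 1 f d.
Proof.
move=> H.
have C0 : 0 <= C.
  have := H (x + 1); rewrite (_ : x + 1 - x = 1) ?expr1n ?mulr1; last by ring.
  exact: le_trans.
apply/is_derive1_caratheodory.
exists (fun z => if z == x then d else (f z - f x) / (z - x)).
rewrite eqxx; split => // [z|].
  by rewrite /=; case: eqP => [->|/eqP]; [rewrite !subrr mulr0|rewrite -subr_eq0 => /divfK].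
have C1 : 0 < C + 1 by rewrite ltr_pwDr.
apply/(@cvgrPdist_lt _ R^o) => e e0; rewrite eqxx.
have := @nbhsx_ballx R R^o x _ (divr_gt0 e0 C1).
apply: filterS => z; rewrite /ball/= distrC => xz.
case: eqP => [_|/eqP zx]; first by rewrite subrr normr0.
rewrite distrC -[d](mulfK (_ : z - x != 0)) ?subr_eq0// -mulrBl normrM normfV.
rewrite ltr_pdivrMr ?normr_gt0 ?subr_eq0//.
apply: le_lt_trans (H z) _; rewrite -[(z - x) ^+ 2]ger0_norm ?sqr_ge0// normrX.
rewrite expr2 mulrA ltr_pM2r ?normr_gt0 ?subr_eq0//.
move: xz; rewrite ltr_pdivlMr// mulrC; apply: le_lt_trans.
by rewrite ler_wpM2r// lerDl.
Qed.

Lemma is_derive_affine (a b x : R) : is_derive x 1 (fun y => a * y + b) a.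
Proof.
apply: (@is_derive_quadratic _ _ 0) => y.
by rewrite mul0r (_ : _ - _ - _ = 0) ?normr0//; ring.
Qed.

Definition sumR (v : nat -> R) : R := limn (series v).

Definition geo_dominated (K : R) (v : nat -> R) :=
  forall n, `|v n| <= K * 2^-1 ^+ n.

Lemma half_norm_lt1 : `|2^-1 : R| < 1.
Proof. by rewrite ger0_norm; lra. Qed.

Lemma geo_dominated_cvg K v : geo_dominated K v -> cvgn (series v).
Proof.
move=> vK; apply: normed_cvg.
apply: (series_le_cvg _ _ vK) => [n|n|]; first exact: normr_ge0.
  exact: le_trans (vK n).
exact: (@is_cvg_geometric_series R K _ half_norm_lt1).
Qed.

Lemma sumR_geo_bound K v : geo_dominated K v -> `|sumR v| <= 2 * K.
Proof.
move=> vK.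
have K0 : 0 <= K by have := vK 0%N; rewrite expr0 mulr1; exact: le_trans.
have cv := geo_dominated_cvg vK.
have B n : `|series v n| <= 2 * K.
  apply: le_trans (ler_norm_sum _ _ _) _.
  apply: (@le_trans _ _ (series (geometric K 2^-1) n)).
    by apply: ler_sum => i _; exact: vK.
  rewrite geometric_seriesE/=; last by rewrite lt_eqF//; lra.
  have -> : K * (1 - 2^-1 ^+ n) / (1 - 2^-1) = 2 * K - 2 * (K * 2^-1 ^+ n) by field.
  by rewrite lerBlDr lerDl !mulr_ge0.
rewrite ler_norml; apply/andP; split.
  by apply: limr_ge => //; apply: nearW => n; have := B n; rewrite ler_norml => /andP[].
by apply: limr_le => //; apply: nearW => n; have := B n; rewrite ler_norml => /andP[].
Qed.

Lemma sumR_lin (v w : nat -> R) (a : R) : cvgn (series v) -> cvgn (series w) ->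
  sumR (fun n => v n + a * w n) = sumR v + a * sumR w.
Proof.
move=> cv cw; rewrite /sumR.
rewrite (_ : (fun _ => _) = v + a *: w)// lim_seriesD//; last exact: is_cvg_seriesZ.
by rewrite lim_seriesZ.
Qed.

(** The domination of the second derivatives [u k.+2] bounds the Taylor remainder of the n-th term
    by K_(k+2) 2^-n (y - x)^2, and these bounds are summed. *)
Lemma is_derive_sumR (u : nat -> nat -> R -> R) (K : nat -> R) k (x : R) :
  (forall k n (y : R), is_derive y 1 (u k n) (u k.+1 n y)) ->
  (forall k y, geo_dominated (K k) (fun n => u k n y)) ->
  is_derive x 1 (fun y => sumR (fun n => u k n y)) (sumR (fun n => u k.+1 n x)).
Proof.
move=> du uK.
apply: (@is_derive_quadratic _ _ (2 * K k.+2)) => y.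
have c j z : cvgn (series (fun n => u j n z)) by exact: geo_dominated_cvg (uK j z).
have cB : cvgn (series (fun n => u k n y + (-1) * u k n x)).
  rewrite (_ : (fun _ => _) = (fun n => u k n y) + (-1) *: (fun n => u k n x))//.
  by apply: is_cvg_seriesD => //; exact: is_cvg_seriesZ.
have -> : sumR (fun n => u k n y) - sumR (fun n => u k n x) -
    sumR (fun n => u k.+1 n x) * (y - x) =
    sumR (fun n => (u k n y + (-1) * u k n x) + - (y - x) * u k.+1 n x).
  by rewrite !sumR_lin//; ring.
rewrite -mulrA; apply: sumR_geo_bound => n.
have -> : u k n y + (-1) * u k n x + - (y - x) * u k.+1 n x =
  u k n y - u k n x - u k.+1 n x * (y - x) by ring.
rewrite mulrAC; apply: (@taylor1_bound _ _ (u k.+2 n)) => // z.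
exact: uK.
Qed.

Lemma smooth_sumR (u : nat -> nat -> R -> R) (K : nat -> R) :
  (forall k n (y : R), is_derive y 1 (u k n) (u k.+1 n y)) ->
  (forall k y, geo_dominated (K k) (fun n => u k n y)) ->
  smooth (fun y => sumR (fun n => u 0%N n y)).
Proof.
move=> du uK.
apply: (@smooth_family _ (fun k y => sumR (fun n => u k n y))) => k x.
exact: is_derive_sumR du uK.
Qed.

End SeriesOfFunctions.

(** * The Cantor attractor *)

Section Attractors.
Variable R : realType.
Implicit Types (f g h : R -> R) (X Y : set R).

Lemma self_similar_conj f0 f1 h g X : cancel h g -> continuous h -> maps01 h ->
  self_similar f0 f1 X ->
  self_similar (h \o f0 \o g) (h \o f1 \o g) (h @` X).
Proof.
move=> hK ch h01 [X01 [x Xx] cX XE]; split.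
- by move=> _ [y Xy <-]; apply: h01; exact: X01.
- by exists (h x); exists x.
- by apply: continuous_compact => //; exact: continuous_subspaceT.
- have E f : (h \o f \o g) @` (h @` X) = h @` (f @` X).
    by rewrite !image_comp; congr image; apply/funext => z /=; rewrite hK.
  by rewrite !E -image_setU -XE.
Qed.

Lemma is_attractor_conj f0 f1 h g X : cancel h g -> cancel g h ->
  continuous h -> continuous g -> maps01 h -> maps01 g ->
  is_attractor f0 f1 X ->
  is_attractor (h \o f0 \o g) (h \o f1 \o g) (h @` X).
Proof.
move=> hK gK ch cg h01 g01 [sX uX]; split; first exact: self_similar_conj.
move=> Y sY; have := self_similar_conj gK cg g01 sY.
have E f : g \o (h \o f \o g) \o h = f.
  by apply/funext => z /=; rewrite !hK.
rewrite !E => /uX <-; rewrite image_comp (_ : h \o g = id) ?image_id//.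
by apply/funext => z; exact: gK.
Qed.

Variable lam : R.
Hypotheses (lam_gt0 : 0 < lam) (lam_lt : lam < 1 / 2).

Lemma smooth_aff0 : smooth (aff0 lam).
Proof.
move=> n; have := Ck_affine n lam 0.
by congr Ck; apply/funext => x; rewrite addr0.
Qed.

Lemma smooth_aff1 : smooth (aff1 lam).
Proof.
move=> n; have := Ck_affine n lam (1 - lam).
by congr Ck; apply/funext => x; rewrite addrA.
Qed.

Fixpoint cantor_step n : set R :=
  if n is n'.+1 then aff0 lam @` cantor_step n' `|` aff1 lam @` cantor_step n'
  else `[0, 1]%classic.

Definition cantor_attractor : set R := \bigcap_n cantor_step n.

Lemma aff0_01 x : 0 <= x <= 1 -> 0 <= aff0 lam x <= lam.
Proof.
have [l0 l1] := (lam_gt0, lam_lt).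
move=> /andP[x0 x1]; have l0' := ltW l0.
by rewrite /aff0 mulr_ge0//= ler_piMr.
Qed.

Lemma aff1_01 x : 0 <= x <= 1 -> 1 - lam <= aff1 lam x <= 1.
Proof.
have [l0 l1] := (lam_gt0, lam_lt).
by move=> /aff0_01 /andP[]; rewrite /aff0 /aff1 => *; apply/andP; split; lra.
Qed.

Lemma cantor_step_compact n : compact (cantor_step n).
Proof.
elim: n => [|n IH] /=; first exact: segment_compact.
apply: compactU; apply: continuous_compact => //; apply: continuous_subspaceT.
  by apply: smooth_continuous; exact: smooth_aff0.
by apply: smooth_continuous; exact: smooth_aff1.
Qed.

Lemma cantor_step_sub n : cantor_step n `<=` `[0, 1]%classic.
Proof.
have [l0 l1] := (lam_gt0, lam_lt).
elim: n => //= n IH x [] [y /IH] /=; rewrite !in_itv/=.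
  move=> /aff0_01 /andP[a b] <-; apply/andP; split; first exact: a.
  lra.
by move=> /aff1_01 /andP[a b] <-; apply/andP; split; lra.
Qed.

Lemma cantor_step0 n : cantor_step n 0.
Proof.
elim: n => [|n IH] /=; first by rewrite in_itv/= lexx ler01.
by left; exists 0 => //; rewrite /aff0 mulr0.
Qed.

Lemma self_similar_cantor : self_similar (aff0 lam) (aff1 lam) cantor_attractor.
Proof.
have [l0 l1] := (lam_gt0, lam_lt).
split.
- by move=> x /(_ 0%N I).
- by exists 0 => n _; exact: cantor_step0.
- apply: (subclosed_compact _ (@segment_compact R 0 1)); last by move=> x /(_ 0%N I).
  apply: closed_bigI => n _; apply: compact_closed; first exact: norm_hausdorff.
  exact: cantor_step_compact.
- apply/seteqP; split => x.
  (* As lam < 1 - lam, the position of x decides which branch it lies in, the same one at every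
     level; its preimage is therefore a single point lying in all the steps. *)
  + move=> Xx; have [xl|xl] := leP x lam.
      left; exists (x / lam); last by rewrite /aff0 mulrC divfK// gt_eqF.
      move=> n _; case: (Xx n.+1 I) => -[y /[dup] Sy /cantor_step_sub].
        by move=> _ <-; rewrite /aff0 mulrC mulKf// gt_eqF.
      by rewrite /= in_itv/= => /aff1_01/andP[a b] xE; move: a; rewrite xE; lra.
    right; exists ((x - (1 - lam)) / lam); last first.
      by rewrite /aff1 mulrC divfK ?gt_eqF//; lra.
    move=> n _; case: (Xx n.+1 I) => -[y /[dup] Sy /cantor_step_sub].
      by rewrite /= in_itv/= => /aff0_01/andP[a b] xE; move: b; rewrite xE; lra.
    move=> _ <-; rewrite /aff1 (_ : _ + 1 - lam - (1 - lam) = lam * y); last by ring.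
    by rewrite mulrC mulKf// gt_eqF.
  + case=> -[y Xy <-] [_|n _] /=.
    * by apply: (@cantor_step_sub 1%N); left; exists y => //; exact: (Xy 0%N I).
    * by left; exists y => //; exact: Xy.
    * by apply: (@cantor_step_sub 1%N); right; exists y => //; exact: (Xy 0%N I).
    * by right; exists y => //; exact: Xy.
Qed.

Lemma is_attractor_cantor : is_attractor (aff0 lam) (aff1 lam) cantor_attractor.
Proof.
have [l0 l1] := (lam_gt0, lam_lt).
split; first exact: self_similar_cantor.
move=> Y [Y01 [y0 Yy0] cY YE].
apply/seteqP; split => x.
  move=> Yx n _; elim: n x Yx => [|n IH] x Yx; first exact: Y01.
  by move: Yx; rewrite {1}YE => -[] [y Yy <-]; [left|right]; exists y => //; exact: IH.
move=> Xx.
(* Both maps contract by lam, so the n-th step is within lam^n of Y; a point of the intersection is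
   then adherent to the closed set Y. *)
have app n z : cantor_step n z -> exists2 y, Y y & `|z - y| <= lam ^+ n.
  elim: n z => [|n IH] z /=.
    rewrite in_itv/= => /andP[z0 z1]; exists y0 => //.
    have := Y01 _ Yy0; rewrite /= in_itv/= => /andP[a b].
    by rewrite expr0 ler_norml; apply/andP; split; lra.
  case=> -[w /IH[y Yy wy] <-].
    exists (aff0 lam y); first by rewrite YE; left; exists y.
    by rewrite /aff0 -mulrBr normrM gtr0_norm// exprS ler_pM2l.
  exists (aff1 lam y); first by rewrite YE; right; exists y.
  rewrite /aff1 (_ : _ - _ = lam * (w - y)); last by ring.
  by rewrite normrM gtr0_norm// exprS ler_pM2l.
have /closure_id -> : closed Y.
  by apply: compact_closed => //; exact: norm_hausdorff.
move=> B /nbhs_ballP[e /= e0 eB].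
have ln : `|lam| < 1 by rewrite gtr0_norm//; lra.
have := @cvg_expr R lam ln.
move/cvgr0Pnorm_lt => /(_ _ e0) [N _ /(_ N (leqnn N)) /= lN].
have [y Yy xy] := app N x (Xx N I).
exists y; split => //; apply: eB; rewrite /ball/=.
by apply: le_lt_trans xy _; rewrite -[ltLHS]gtr0_norm// exprn_gt0.
Qed.

(** Words of length n are coded by k < 2^n with the last, finest letter in the lowest bit: [k./2] is
    the parent word, and [k.*2], [k.*2.+1] are the children. *)
Fixpoint cylinder_left n k : R :=
  if n is n'.+1 then
    cylinder_left n' k./2 + (odd k)%:R * ((1 - lam) * lam ^+ n')
  else 0.

Lemma cylinder_leftS n (b : bool) k : cylinder_left n.+1 (b + k.*2) =
  cylinder_left n k + b%:R * ((1 - lam) * lam ^+ n).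
Proof.
by rewrite /cylinder_left -/cylinder_left half_bit_double oddD odd_double oddb addbF.
Qed.

Lemma cantor_cylinder x n : cantor_attractor x -> exists k y,
  [/\ (k < 2 ^ n)%N, cantor_attractor y & x = cylinder_left n k + lam ^+ n * y].
Proof.
move=> Xx; elim: n => [|n [k [y [kn Xy ->]]]].
  by exists 0%N, x; split => //; rewrite expr0 mul1r add0r.
have [_ _ _ XE] := self_similar_cantor.
rewrite XE in Xy; case: Xy => -[z Xz <-].
  exists k.*2, z; split => //; first by rewrite expnS mul2n ltn_double.
  by rewrite -[k.*2]/(false + k.*2)%N cylinder_leftS mul0r addr0 /aff0 exprSr mulrA.
exists k.*2.+1, z; split => //; first by rewrite expnS mul2n ltn_Sdouble.
rewrite -[k.*2.+1]/(true + k.*2)%N cylinder_leftS mul1r /aff1 exprSr; ring.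
Qed.

End Attractors.

(** * The Cantor distribution function *)

Section ProbabilitiesOnTheLine.
Variable R : realType.
Implicit Types (F : R -> R).

Lemma measure_eq_cdf (m1 m2 : {measure set (measurableTypeR R) -> \bar R}) :
  (forall r, (m1 `]-oo, r]%classic < +oo)%E) ->
  (forall r, m1 `]-oo, r]%classic = m2 `]-oo, r]%classic) ->
  forall A : set (measurableTypeR R), measurable A -> m1 A = m2 A.
Proof.
move=> fin1 E A mA.
have fin2 r : (m2 `]-oo, r]%classic < +oo)%E by rewrite -E.
refine (@measure_unique _ R (measurableTypeR R) (@ocitv R)
  (fun n : nat => `](- n%:R : R), n%:R]%classic) _ _ _ _ m1 m2 _ _ A mA) => //.
- exact: ocitvI.
- by move=> n; exact: is_ocitv.
- exact: bigcup_itvT.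
- move=> _ [[a b] _ <-] /=.
  have [ab|ba] := leP a b; last first.
    by rewrite set_itv_ge ?measure0// bnd_simp -leNgt ltW.
  have -> : `]a, b]%classic = `]-oo, b]%classic `\` `]-oo, a]%classic :> set R.
    by rewrite -[RHS]setCK setCD setCitvl setUC -[LHS]setCK setCitv.
  have sub : `]-oo, a]%classic `<=` `]-oo, b]%classic by exact: subset_itvl.
  have D (m : {measure set (measurableTypeR R) -> \bar R}) :
      (m `]-oo, b]%classic < +oo)%E ->
      m (`]-oo, b]%classic `\` `]-oo, a]%classic) =
      (m `]-oo, b]%classic - m `]-oo, a]%classic)%E.
    by move=> fin; rewrite measureD// (setIidr sub).
  by rewrite !D ?fin1 ?fin2// !E.
- move=> k; apply: le_lt_trans (fin1 k%:R).
  by apply: le_measure; rewrite ?inE//; exact: subset_itvr.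
Qed.

Lemma exists_probability_of_cdf F : nondecreasing F -> right_continuous F ->
  F x @[x --> -oo] --> (0 : R) -> F x @[x --> +oo] --> (1 : R) ->
  exists P : probability (measurableTypeR R) R,
    forall r, P `]-oo, r]%classic = (F r)%:E.
Proof.
move=> nd rc F0 F1.
pose Fc : cumulativeBounded (0 : R) (1 : R) := HB.pack F
  (isCumulative.Build R _ R F nd rc) (isCumulativeBounded.Build R 0 1 F F0 F1).
exists (lebesgue_stieltjes_measure Fc) => r.
exact: (cdf_lebesgue_stieltjes_id Fc r).
Qed.

Lemma prob_setI_full (P : probability (measurableTypeR R) R)
    (D A : set (measurableTypeR R)) :
  measurable D -> measurable A -> P D = 1%E -> P (D `&` A) = P A.
Proof.
move=> mD mA PD.
have PDc : P (~` D) = 0%E by rewrite probability_setC// PD subee.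
rewrite -[in RHS](setIT A) -(setUv D) setIUr measureU; last first.
- by rewrite setIACA setICr setI0.
- exact: measurableI (measurableC mD).
- exact: measurableI.
rewrite [X in (_ + X)%E](_ : _ = 0%E) ?adde0 1?setIC//.
apply/eqP; rewrite eq_le measure_ge0 andbT -PDc.
have mDC := measurableC mD.
by apply: le_measure; rewrite ?inE//; exact: measurableI.
Qed.

End ProbabilitiesOnTheLine.

Section CantorDistribution.
Variables (R : realType) (lam : R).
Hypotheses (lam_gt0 : 0 < lam) (lam_lt : lam < 1 / 2).
Implicit Types (F G : R -> R).

(** The stationarity equation read on distribution functions: the arguments are the preimages of x
    under the two affine maps. *)
Definition cdf_step F (x : R) : R := (F (x / lam) + F ((x - (1 - lam)) / lam)) / 2.

Definition cdf01 F := [/\ nondecreasing F, forall x, x < 0 -> F x = 0 &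
  forall x, 1 <= x -> F x = 1].

Lemma cdf01_bounds F x : cdf01 F -> 0 <= F x <= 1.
Proof.
move=> [nd F0 F1]; apply/andP; split.
  have [x0|x0] := ltP x 0; first by rewrite F0.
  by rewrite -(F0 (-1)) ?ltrN10//; apply: nd; lra.
have [x1|x1] := leP 1 x; first by rewrite F1.
by rewrite -(F1 1)//; apply: nd; exact: ltW.
Qed.

(** Since lam < 1/2, at each x one of the two arguments in [cdf_step] is negative or at least 1,
    where F and G agree. Only one term contributes, and each application halves the distance between
    F and G. *)
Lemma cdf01_fixpoint_unique F G : cdf01 F -> cdf01 G ->
  F =1 cdf_step F -> G =1 cdf_step G -> F =1 G.
Proof.
have [l0 l1] := (lam_gt0, lam_lt).
move=> cF cG FE GE x.
have [[_ F0 F1] [_ G0 G1]] := (cF, cG).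
suff H n : forall x, `|F x - G x| <= 2^-1 ^+ n.
  apply/eqP; rewrite -subr_eq0 -normr_le0.
  have hn : `|2^-1 : R| < 1 by rewrite ger0_norm; lra.
  by apply: ler_cvg_to (cvg_cst _) (cvg_expr hn) _; apply: nearW => n.
elim: n => {x} [|n IH] x.
  rewrite expr0; have /andP[a b] := cdf01_bounds x cF.
  have /andP[c d] := cdf01_bounds x cG.
  by rewrite ler_norml; apply/andP; split; lra.
rewrite FE GE /cdf_step exprS.
have [xl|lx] := ltP x (1 - lam).
  have neg : (x - (1 - lam)) / lam < 0 by rewrite pmulr_llt0 ?invr_gt0//; lra.
  rewrite (F0 _ neg) (G0 _ neg) !addr0 -mulrBl normrM mulrC.
  by rewrite ger0_norm ?invr_ge0// ler_pM2l// invr_gt0.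
have pos : 1 <= x / lam by rewrite ler_pdivlMr//; lra.
rewrite (F1 _ pos) (G1 _ pos) -mulrBl normrM mulrC.
rewrite ger0_norm ?invr_ge0// ler_pM2l ?invr_gt0//.
by rewrite (_ : 1 + _ - _ = F ((x - (1 - lam)) / lam) - G ((x - (1 - lam)) / lam)) //; ring.
Qed.

Lemma cdf01_step F : cdf01 F -> cdf01 (cdf_step F).
Proof.
have [l0 l1] := (lam_gt0, lam_lt).
move=> [nd F0 F1]; split => [x y xy|x x0|x x1]; rewrite /cdf_step.
- rewrite ler_pM2r ?invr_gt0//; apply: lerD; apply: nd;
    rewrite ler_pM2r ?invr_gt0//.
  by rewrite lerB.
- by rewrite !F0 ?addr0 ?mul0r//; rewrite pmulr_llt0 ?invr_gt0//; lra.
- rewrite !F1; first by field.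
  + by rewrite ler_pdivlMr//; lra.
  + by rewrite ler_pdivlMr//; lra.
Qed.

(** The start is the distribution function of the Dirac mass at 0, the largest function in [cdf01];
    hence the iterates decrease. *)
Fixpoint cdf_approx n : R -> R :=
  if n is n'.+1 then cdf_step (cdf_approx n') else fun x => (0 <= x)%R%:R.

Lemma cdf01_approx n : cdf01 (cdf_approx n).
Proof.
elim: n => [|n IH]; last exact: cdf01_step.
split=> [x y xy|x x0|x x1] /=.
- by rewrite ler_nat; case: (leP 0 x) => // x0; rewrite (le_trans x0 xy).
- by move: x0; rewrite ltNge => /negbTE ->.
- by rewrite (le_trans ler01 x1).
Qed.

Lemma cdf_approx_decreasing n x : cdf_approx n.+1 x <= cdf_approx n x.
Proof.
elim: n x => [|n IH] x; last first.
  by rewrite /= /cdf_step ler_pM2r ?invr_gt0// lerD// IH.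
have [x0|x0] := ltP x 0.
  have [_ F0 _] := cdf01_approx 1; have [_ G0 _] := cdf01_approx 0.
  by rewrite F0// G0.
have -> : cdf_approx 0 x = 1 by rewrite /= x0.
by have /andP[] := cdf01_bounds x (cdf01_approx 1).
Qed.

Lemma cdf_approx_right n x (e : R) : 0 < e ->
  exists2 d : R, 0 < d & forall y, y < x + d -> cdf_approx n y <= cdf_approx n x + e.
Proof.
have l0 := lam_gt0.
elim: n x e => [|n IH] x e e0.
  have [x0|x0] := ltP x 0.
    exists (- x); first by rewrite oppr_gt0.
    move=> y; rewrite subrr /= ltNge => /negbTE ->.
    by rewrite addr_ge0// ltW.
  exists 1 => // y _ /=; rewrite x0; apply: le_trans (_ : 1 <= _).
    by case: (0 <= y); rewrite ?ler01.
  by rewrite lerDl ltW.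
have [d1 d10 H1] := IH (x / lam) e e0.
have [d2 d20 H2] := IH ((x - (1 - lam)) / lam) e e0.
exists (lam * Num.min d1 d2); first by rewrite mulr_gt0// lt_min d10.
move=> y yx.
have m1 : Num.min d1 d2 <= d1 by rewrite ge_min lexx.
have m2 : Num.min d1 d2 <= d2 by rewrite ge_min lexx orbT.
have yl : (y - x) / lam < Num.min d1 d2.
  by rewrite ltr_pdivrMr// mulrC ltrBlDl.
have K1 : y / lam < x / lam + d1 by move: yl; rewrite mulrBl; lra.
have K2 : (y - (1 - lam)) / lam < (x - (1 - lam)) / lam + d2.
  by move: yl; rewrite !mulrBl; lra.
have := H1 _ K1; have := H2 _ K2; rewrite /= /cdf_step; lra.
Qed.

Definition cantor_cdf (x : R) : R := limn (fun n => cdf_approx n x).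

Lemma cdf_approx_noninc x : nonincreasing_seq (fun n => cdf_approx n x).
Proof. by apply/nonincreasing_seqP => n; exact: cdf_approx_decreasing. Qed.

Lemma cdf_approx_cvg x : cdf_approx n x @[n --> \oo] --> cantor_cdf x.
Proof.
apply: nonincreasing_is_cvgn; first exact: cdf_approx_noninc.
exists 0 => _ [n _ <-].
by have /andP[] := cdf01_bounds x (cdf01_approx n).
Qed.

Lemma cantor_cdf_le n x : cantor_cdf x <= cdf_approx n x.
Proof.
apply: nonincreasing_cvgn_ge; first exact: cdf_approx_noninc.
exact: cdf_approx_cvg.
Qed.

Lemma cdf01_cantor : cdf01 cantor_cdf.
Proof.
split => [x y xy|x x0|x x1].
- have nxy : \forall n \near \oo, cdf_approx n x <= cdf_approx n y.
    by apply: nearW => n; have [nd _ _] := cdf01_approx n; exact: nd.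
  exact: (ler_cvg_to (@cdf_approx_cvg x) (@cdf_approx_cvg y) nxy).
- apply: cvg_lim => //; apply: cvg_near_cst; apply: nearW => n.
  by have [_ F0 _] := cdf01_approx n; exact: F0.
- apply: cvg_lim => //; apply: cvg_near_cst; apply: nearW => n.
  by have [_ _ F1] := cdf01_approx n; exact: F1.
Qed.

Lemma cantor_cdf_fixpoint : cantor_cdf =1 cdf_step cantor_cdf.
Proof.
move=> x; apply: (@cvg_unique _ (@norm_hausdorff _ R^o) (cdf_approx n.+1 x @[n --> \oo])).
  by move: (@cdf_approx_cvg x); rewrite -(cvg_shiftS (cdf_approx ^~ x)).
by rewrite /= /cdf_step; apply: cvgMr_tmp; apply: cvgD; exact: cdf_approx_cvg.
Qed.

(** The upper bound to the right of x holds for a close approximation from above and passes down to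
    the limit; monotonicity supplies the lower bound. *)
Lemma cantor_cdf_right_continuous : right_continuous cantor_cdf.
Proof.
have [nd _ _] := cdf01_cantor.
move=> x; apply/(@cvgrPdist_le _ R^o) => e e0.
have e2 : 0 < e / 2 by rewrite divr_gt0.
have [n nx] : exists n, cdf_approx n x <= cantor_cdf x + e / 2.
  have /(@cvgrPdist_le _ R^o) /(_ _ e2) [n _ /(_ n (leqnn n)) /=] := @cdf_approx_cvg x.
  by rewrite ler_norml => /andP[H _]; exists n; lra.
have [d d0 H] := cdf_approx_right n x e2.
exists d => //= y; rewrite /ball/= => xy ltxy.
have yx : y < x + d by move: xy; rewrite distrC ltr_norml => /andP[_]; lra.
have := H y yx; have := cantor_cdf_le n y; have := nd _ _ (ltW ltxy).
by move=> a b c; rewrite ler_norml; apply/andP; split; lra.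
Qed.

End CantorDistribution.

(** * Stationary measures *)

Section StationaryMeasures.
Variable R : realType.
Implicit Types (f g h : R -> R) (P Q mu nu : probability (measurableTypeR R) R).

Lemma continuous_measurableR f : continuous f ->
  measurable_fun setT (f : measurableTypeR R -> measurableTypeR R).
Proof. exact: continuous_measurable_fun. Qed.

Lemma measurable_preimageR f (A : set (measurableTypeR R)) : continuous f ->
  measurable A -> measurable (f @^-1` A : set (measurableTypeR R)).
Proof.
by move=> cf mA; rewrite -[X in measurable X]setTI; exact: continuous_measurableR.
Qed.

Lemma exists_pushforward P f : continuous f ->
  exists Q, forall A : set (measurableTypeR R), Q A = P (f @^-1` A).
Proof.
move=> cf.
pose X : {mfun measurableTypeR R >-> measurableTypeR R} :=
  HB.pack (f : measurableTypeR R -> measurableTypeR R)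
    (isMeasurableFun.Build _ _ _ _ _ (continuous_measurableR cf)).
by exists (distribution P X).
Qed.

Lemma integrable_continuous_bounded P f M : continuous f ->
  (forall x, `|f x| <= M) -> P.-integrable setT (EFin \o f).
Proof.
move=> cf fM; apply: measurable_bounded_integrable => //.
- exact: le_lt_trans (probability_le1 P measurableT) (ltry 1).
- exact: continuous_measurableR.
- by exists M; split => [|N MN x _]; [exact: num_real|exact: le_trans (ltW MN)].
Qed.

Lemma Rintegral_pushforward P Q f g M : continuous f -> continuous g ->
  (forall x, `|g x| <= M) ->
  (forall A : set (measurableTypeR R), Q A = P (f @^-1` A)) ->
  Rintegral Q setT g = Rintegral P setT (g \o f).
Proof.
move=> cf cg gM QE.
have mf := continuous_measurableR cf.
rewrite /Rintegral; congr fine.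
have mg : measurable_fun setT (EFin \o g : measurableTypeR R -> \bar R).
  by apply/measurable_EFinP; apply: continuous_measurableR.
have ig : P.-integrable (f @^-1` setT) ((EFin \o g) \o f).
  rewrite preimage_setT.
  apply: (@integrable_continuous_bounded P (g \o f) M) => [x|x]; last exact: gM.
  by apply: continuous_comp; [exact: cf|exact: cg].
have := integral_pushforward mf mg ig measurableT.
rewrite preimage_setT => <-.
by apply: eq_measure_integral => A mA _; exact: QE.
Qed.

Lemma half_sumE (x a b : \bar R) : x \is a fin_num -> a \is a fin_num ->
  b \is a fin_num ->
  (x = (2^-1)%:E * a + (2^-1)%:E * b <-> x + x = a + b)%E.
Proof.
case: x a b => [x||] [a||] [b||] // _ _ _.
rewrite -!EFinM -!EFinD; split => -[H]; congr EFin; move: H; lra.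
Qed.

(** Doubling clears the scalars, so that stationarity compares two sums of measures; the
    intersection with [0, 1] in [push01] disappears because mu has full mass there. *)
Lemma stationaryP f0 f1 mu : continuous f0 -> continuous f1 ->
  stationary f0 f1 mu <-> mu `[0, 1]%classic = 1%E /\
    forall A : set (measurableTypeR R), measurable A ->
      (mu A + mu A = mu (f0 @^-1` A) + mu (f1 @^-1` A))%E.
Proof.
move=> c0 c1.
have E f (A : set (measurableTypeR R)) : continuous f -> measurable A ->
    mu `[0, 1]%classic = 1%E -> push01 f mu A = mu (f @^-1` A).
  move=> cf mA mu1; rewrite /push01 prob_setI_full//.
  exact: measurable_preimageR.
have F f (A : set (measurableTypeR R)) : continuous f -> measurable A ->
  mu (f @^-1` A) \is a fin_num.
  by move=> cf mA; apply: fin_num_measure; exact: measurable_preimageR.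
split=> -[mu1 H]; split => // A mA.
  by have := H A mA; rewrite !E// => /half_sumE; apply => //;
    [exact: fin_num_measure|exact: F|exact: F].
by rewrite !E//; apply/half_sumE; [exact: fin_num_measure|exact: F|exact: F|exact: H].
Qed.

Lemma stationary_Rintegral f0 f1 mu f M : continuous f0 -> continuous f1 ->
  stationary f0 f1 mu -> continuous f -> (forall x, `|f x| <= M) ->
  Rintegral mu setT f =
  (Rintegral mu setT (f \o f0) + Rintegral mu setT (f \o f1)) / 2.
Proof.
move=> c0 c1 /(stationaryP _ c0 c1)[_ S] cf fM.
have [Q0 Q0E] := exists_pushforward mu c0.
have [Q1 Q1E] := exists_pushforward mu c1.
have i P : P.-integrable setT (EFin \o f) by exact: integrable_continuous_bounded fM.
have fi P : (\int[P]_x (f x)%:E)%E \is a fin_num by exact: integrable_fin_num (i P).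
have mf : measurable_fun setT (EFin \o f : measurableTypeR R -> \bar R).
  by apply/measurable_EFinP; apply: continuous_measurableR.
have H : (\int[measure_add mu mu]_x (f x)%:E = \int[measure_add Q0 Q1]_x (f x)%:E)%E.
  apply: eq_measure_integral => A mA _.
  have := S A mA; rewrite -Q0E -Q1E => SA.
  exact: etrans (measure_addE mu mu A) (etrans SA (esym (measure_addE Q0 Q1 A))).
move: H; rewrite (integral_measure_add _ (i mu) (i mu))//.
rewrite (integral_measure_add _ (i Q0) (i Q1))//.
rewrite -(Rintegral_pushforward c0 cf fM Q0E) -(Rintegral_pushforward c1 cf fM Q1E).
rewrite /Rintegral; move: (fi mu) (fi Q0) (fi Q1).
case: integral => [a||]//; case: integral => [b||]//; case: integral => [c||]//.
by move=> _ _ _ [] /=; lra.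
Qed.

(** Uniqueness is pulled back: the image under g of a competitor of nu is stationary for the
    original system, hence equals mu. *)
Lemma is_uniform_stationary_conj f0 f1 h g mu nu : cancel h g -> cancel g h ->
  continuous h -> continuous g -> continuous f0 -> continuous f1 ->
  (forall x, (h x \in `[0, 1]) = (x \in `[0, 1])) ->
  (forall A : set (measurableTypeR R), nu A = mu (h @^-1` A)) ->
  is_uniform_stationary f0 f1 mu ->
  is_uniform_stationary (h \o f0 \o g) (h \o f1 \o g) nu.
Proof.
move=> hK gK ch cg c0 c1 h01 nuE [smu umu].
have cc f : continuous f -> continuous (h \o f \o g).
  move=> cf x; apply: (@continuous_comp _ _ _ g (h \o f)); first exact: cg.
  by apply: (@continuous_comp _ _ _ f h); [exact: cf|exact: ch].
have pre (k : R -> R) : (forall x, (k x \in `[0, 1]) = (x \in `[0, 1])) ->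
    k @^-1` `[0, 1]%classic = `[0, 1]%classic.
  by move=> k01; apply/seteqP; split => x /=; rewrite k01.
have g01 x : (g x \in `[0, 1]) = (x \in `[0, 1]) by rewrite -h01 gK.
split.
  apply/stationaryP => //; [exact: cc|exact: cc|].
  move/stationaryP : smu => /(_ c0 c1)[mu1 S]; split; first by rewrite nuE pre.
  move=> A mA; have := S _ (measurable_preimageR ch mA); rewrite !nuE => ->.
  by congr (mu _ + mu _)%E; apply/seteqP; split => x /=; rewrite hK.
move=> nu' snu' A mA.
have [mu' mu'E] := exists_pushforward nu' cg.
have smu' : stationary f0 f1 mu'.
  move/stationaryP : snu' => /(_ (cc _ c0) (cc _ c1))[nu1 S].
  apply/stationaryP => //; split; first by rewrite mu'E pre.
  move=> B mB; have := S _ (measurable_preimageR cg mB); rewrite !mu'E => ->.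
  by congr (nu' _ + nu' _)%E; apply/seteqP; split => x /=; rewrite hK.
rewrite nuE -(umu _ smu'); last exact: measurable_preimageR.
by rewrite mu'E; congr (nu' _); apply/seteqP; split => x /=; rewrite gK.
Qed.

Variable lam : R.
Hypotheses (lam_gt0 : 0 < lam) (lam_lt : lam < 1 / 2).

Lemma continuous_aff0 : continuous (aff0 lam).
Proof. by apply: smooth_continuous; exact: smooth_aff0. Qed.

Lemma continuous_aff1 : continuous (aff1 lam).
Proof. by apply: smooth_continuous; exact: smooth_aff1. Qed.

Lemma aff0_preimage_ray r :
  aff0 lam @^-1` `]-oo, r]%classic = `]-oo, r / lam]%classic.
Proof.
apply/seteqP; split => x /=; rewrite !in_itv/= /aff0.
  by rewrite ler_pdivlMr// mulrC.
by rewrite ler_pdivlMr// mulrC.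
Qed.

Lemma aff1_preimage_ray r :
  aff1 lam @^-1` `]-oo, r]%classic = `]-oo, (r - (1 - lam)) / lam]%classic.
Proof.
apply/seteqP; split => x /=; rewrite !in_itv/= /aff1 ler_pdivlMr// mulrC; lra.
Qed.

(** Stationarity tested on rays makes the distribution function of mu a fixed point of [cdf_step] in
    [cdf01]; this is the uniqueness half for the affine system. *)
Lemma stationary_cdf mu : stationary (aff0 lam) (aff1 lam) mu ->
  forall r, mu `]-oo, r]%classic = (cantor_cdf lam r)%:E.
Proof.
move=> /(stationaryP _ continuous_aff0 continuous_aff1)[mu1 S].
pose G r := fine (mu `]-oo, r]%classic).
have GE r : mu `]-oo, r]%classic = (G r)%:E by rewrite fineK// fin_num_measure.
suff H : G =1 cantor_cdf lam by move=> r; rewrite GE H.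
apply: (cdf01_fixpoint_unique lam_gt0 lam_lt) => //.
- split => [x y xy|x x0|x x1].
  + rewrite -lee_fin -!GE; apply: le_measure; rewrite ?inE//.
    exact: subset_itvl.
  + rewrite /G -(prob_setI_full _ _ mu1)// (_ : _ `&` _ = set0) ?measure0//.
    apply/seteqP; split => y //=; rewrite !in_itv/= => -[/andP[y0 _] yx].
    by have := lt_le_trans x0 (le_trans y0 yx); rewrite ltxx.
  + rewrite /G -(prob_setI_full _ _ mu1)// (_ : _ `&` _ = `[0, 1]%classic) ?mu1//.
    apply/seteqP; split => y /=; first by case.
    by rewrite !in_itv/= => /andP[y0 y1]; split; rewrite ?y0// (le_trans y1).
- exact: cdf01_cantor.
- move=> r; have := S _ (measurable_itv `]-oo, r]).
  by rewrite aff0_preimage_ray aff1_preimage_ray !GE -!EFinD /cdf_step => -[]; lra.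
- exact: cantor_cdf_fixpoint.
Qed.

Lemma exists_cantor_measure :
  exists mu, is_uniform_stationary (aff0 lam) (aff1 lam) mu.
Proof.
have [nd F0 F1] := cdf01_cantor lam_gt0 lam_lt.
have rc := cantor_cdf_right_continuous lam_gt0 lam_lt.
have [mu muE] : exists mu, forall r, mu `]-oo, r]%classic = (cantor_cdf lam r)%:E.
  apply: exists_probability_of_cdf => //.
    apply: cvg_near_cst; near=> x; apply: F0; near: x.
    by exists 0; split => //; exact: num_real.
  apply: cvg_near_cst; near=> x; apply: F1; near: x.
  by exists 1; split => // y; exact: ltW.
exists mu.
have smu : stationary (aff0 lam) (aff1 lam) mu.
  apply/(stationaryP _ continuous_aff0 continuous_aff1); split.
    (* [cdf01] gives the value 0 at negative points, so the open ray is exhausted by the null rays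
       ending at -1/(n+1). *)
    have N0 : mu `]-oo, 0[%classic = 0%E.
      pose B : set (measurableTypeR R) :=
        \bigcup_n `]-oo, (- n.+1%:R^-1 : R)]%classic.
      have mB : measurable B by apply: bigcup_measurable.
      have B0 : mu B = 0%E.
        apply/(negligibleP _ mB); apply: negligible_bigcup => n.
        apply/negligibleP => //.
        by apply: (etrans (muE _)); rewrite F0// oppr_lt0.
      rewrite -B0.
      congr (mu _); apply/seteqP; split => x /=; rewrite in_itv/=.
        move=> x0; have [n] := ltr_add_invr x0.
        by move=> /ltW; rewrite -lerBrDr sub0r => H; exists n.
      move=> [n _] /=; rewrite in_itv/= => /le_lt_trans; apply.
      by rewrite oppr_lt0.
    have -> : `[0, 1]%classic = `]-oo, 1]%classic `\` `]-oo, 0[%classic :> set R.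
      apply/seteqP; split => x /=; rewrite !in_itv/=.
        by move=> /andP[x0 ->]; split => //; rewrite ltNge x0.
      by move=> [-> /negP]; rewrite -leNgt => ->.
    have fin : (mu `]-oo, 1%R]%classic < +oo)%E by rewrite muE ltry.
    have sub : `]-oo, (0 : R)[%classic `<=` `]-oo, 1]%classic.
      by apply: subset_itvl; rewrite bnd_simp.
    transitivity (mu `]-oo, 1%R]%classic - mu `]-oo, 0%R[%classic)%E.
      by rewrite measureD// (setIidr sub).
    by rewrite muE N0 F1// sube0.
  have [Q0 Q0E] := exists_pushforward mu continuous_aff0.
  have [Q1 Q1E] := exists_pushforward mu continuous_aff1.
  move=> A mA; rewrite -Q0E -Q1E.
  suff E : measure_add mu mu A = measure_add Q0 Q1 A.
    exact: etrans (esym (measure_addE mu mu A)) (etrans E (measure_addE Q0 Q1 A)).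
  have M r : measure_add mu mu `]-oo, r]%classic =
      ((cantor_cdf lam r)%:E + (cantor_cdf lam r)%:E)%E.
    exact: etrans (measure_addE mu mu _) (f_equal2 adde (muE r) (muE r)).
  apply: measure_eq_cdf mA => r.
    by apply: le_lt_trans (ltry (cantor_cdf lam r + cantor_cdf lam r));
      rewrite EFinD le_eqVlt; apply/orP; left; apply/eqP; exact: M.
  apply: (etrans (M r)); apply: (etrans _ (esym (measure_addE Q0 Q1 _))).
  have -> : ((cantor_cdf lam r)%:E + (cantor_cdf lam r)%:E =
      Q0 `]-oo, r]%classic + Q1 `]-oo, r]%classic)%E.
    rewrite Q0E Q1E aff0_preimage_ray aff1_preimage_ray !muE -!EFinD.
    by rewrite [cantor_cdf lam r](cantor_cdf_fixpoint lam_gt0 lam_lt r) /cdf_step;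
      congr EFin; field.
  by [].
split => // mu' smu' A mA; apply: measure_eq_cdf mA => r.
  exact: le_lt_trans (probability_le1 mu' (measurable_itv _)) (ltry 1).
exact: etrans (stationary_cdf smu' r) (esym (muE r)).
Unshelve. all: by end_near. Qed.

End StationaryMeasures.

(** * Exponential moments and random choices *)

Section ChernoffAveraging.
Variable R : realType.

(** From exp(-x) >= 1 - x one has exp(x) <= 1/(1 - x), and (1 + x + 2x^2)(1 - x) = 1 + x^2 (1 - 2x)
    >= 1. *)
Lemma expR_le_quadratic (x : R) : x <= 1 / 2 -> expR x <= 1 + x + 2 * x ^+ 2.
Proof.
move=> x12; have x1 : 0 < 1 - x by lra.
have : (expR x)^-1 >= 1 - x by rewrite -expRN; exact: expR_ge1Dx.
rewrite -[X in X <= _]invrK lef_pV2 ?posrE ?invr_gt0 ?expR_gt0// => H.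
apply: le_trans H _; rewrite -[X in X <= _]mul1r ler_pdivrMr//.
have : 0 <= x ^+ 2 * (1 - 2 * x) by rewrite mulr_ge0 ?sqr_ge0//; lra.
rewrite (_ : (1 + x + 2 * x ^+ 2) * (1 - x) = 1 + x ^+ 2 * (1 - 2 * x)); last by ring.
by rewrite lerDl.
Qed.

Lemma exists_le_average (I : finType) (f : I -> R) (B : R) :
  (0 < #|I|)%N -> \sum_i f i <= #|I|%:R * B -> exists i, f i <= B.
Proof.
move=> I0 H; apply/existsP; apply: contraT; rewrite negb_exists => /forallP Hn.
have : #|I|%:R * B < \sum_i f i; last by rewrite ltNge H.
rewrite mulr_natl -sumr_const; apply: ltr_sum.
  by move: I0; rewrite -cardsT => /card_gt0P [i _]; apply/hasP; exists i => //;
    exact: mem_index_enum.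
by move=> i _; rewrite ltNge.
Qed.

Variables (J K V : finType) (d : J -> K -> V -> R).
Hypotheses (V_gt0 : (0 < #|V|)%N) (J_gt0 : (0 < #|J|)%N).
Hypothesis d_le2 : forall j k v, `|d j k v| <= 2.
Hypothesis d_mean0 : forall j k, \sum_v d j k v = 0.

(* The functions [q] are drawn uniformly, so the coordinates are independent and
   the exponential moment factors over [K] by [bigA_distr_bigA]. *)
Lemma chernoff_choice_one_sided (t : R) : 0 < t -> 4 * t <= 1 ->
  exists q : {ffun K -> V}, forall j,
    \sum_k d j k (q k) <= (ln #|J|%:R + 8 * t ^+ 2 * #|K|%:R) / t.
Proof.
move=> t0 t14.
have J0 : 0 < #|J|%:R :> R by rewrite ltr0n.
pose Phi (q : {ffun K -> V}) : R := \sum_j \prod_k expR (t * d j k (q k)).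
pose B : R := #|J|%:R * expR (8 * t ^+ 2 * #|K|%:R).
have [q qB] : exists q, Phi q <= B.
  apply: exists_le_average; first by rewrite card_ffun expn_gt0 V_gt0.
  rewrite exchange_big /= card_ffun natrX.
  under eq_bigr => j _ do
    rewrite -(bigA_distr_bigA (fun k v => expR (t * d j k v))).
  have -> : #|V|%:R ^+ #|K| * B = \sum_(j : J) (#|V|%:R * expR (8 * t ^+ 2)) ^+ #|K|.
    by rewrite sumr_const -[RHS]mulr_natl exprMn -expRM_natr /B mulrCA.
  apply: ler_sum => j _.
  rewrite -prodr_const; apply: ler_prod => k _; apply/andP; split.
    by apply: sumr_ge0 => v _; exact: expR_ge0.
  (* With |d| <= 2, the condition 4t <= 1 gives t d <= 1/2 and the quadratic term is at most 8 t^2;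
     the linear term vanishes on averaging over v. *)
  have lin v : expR (t * d j k v) <= 1 + t * d j k v + 8 * t ^+ 2.
    have /andP[dl du] : - 2 <= d j k v <= 2 by rewrite -ler_norml.
    have td : t * d j k v <= 1 / 2.
      by apply: le_trans (_ : t * 2 <= _); [rewrite ler_pM2l|lra].
    apply: le_trans (expR_le_quadratic td) _; rewrite lerD2l exprMn.
    have d4 : d j k v ^+ 2 <= 4 by nra.
    by have := ler_wpM2l (sqr_ge0 t) d4; lra.
  apply: le_trans (ler_sum _ (fun v _ => lin v)) _.
  rewrite big_split/= big_split/= -mulr_sumr d_mean0 mulr0 addr0.
  rewrite !sumr_const -mulrnDl -[X in X <= _]mulr_natl ler_pM2l ?ltr0n//.
  exact: expR_ge1Dx.
(* Union bound: the exponential of a single j is at most the whole sum [Phi q], and taking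
   logarithms produces ln #|J|. *)
exists q => j; rewrite ler_pdivlMr// mulrC mulr_sumr.
rewrite -ler_expR expRD lnK ?posrE//; apply: le_trans qB.
rewrite expR_sum /Phi (bigD1 j)//= lerDl sumr_ge0// => i _.
by apply: prodr_ge0 => k _; exact: expR_ge0.
Qed.

End ChernoffAveraging.

(** A sign is added to the index j, so both tails are handled at once; this doubles the index set
    under the logarithm. *)
Lemma chernoff_choice (R : realType) (J K V : finType) (d : J -> K -> V -> R)
    (t : R) : (0 < #|V|)%N -> (0 < #|J|)%N ->
  (forall j k v, `|d j k v| <= 2) -> (forall j k, \sum_v d j k v = 0) ->
  0 < t -> 4 * t <= 1 -> exists q : {ffun K -> V}, forall j,
    `|\sum_k d j k (q k)| <= (ln (2 * #|J|)%:R + 8 * t ^+ 2 * #|K|%:R) / t.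
Proof.
move=> V0 J0 d2 d0 t0 t14.
pose d' (js : J * bool) k v := (-1) ^+ js.2 * d js.1 k v.
have J20 : (0 < #|{: J * bool}|)%N by rewrite card_prod card_bool muln_gt0 J0.
have d'2 js k v : `|d' js k v| <= 2 by rewrite normrM normr_sign mul1r.
have d'0 js k : \sum_v d' js k v = 0 by rewrite -mulr_sumr d0 mulr0.
have [q qP] := chernoff_choice_one_sided V0 J20 d'2 d'0 t0 t14.
exists q => j; rewrite card_prod card_bool mulnC in qP.
rewrite ler_norml lerNl -sumrN; apply/andP; split.
  apply: le_trans (qP (j, true)); rewrite le_eqVlt; apply/orP; left; apply/eqP.
  by apply: eq_bigr => k _; rewrite /d' /= expr1 mulN1r.
apply: le_trans (qP (j, false)); rewrite le_eqVlt; apply/orP; left; apply/eqP.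
by apply: eq_bigr => k _; rewrite /d' /= expr0 mul1r.
Qed.

(** * Exponential sums over words *)

Section Phases.
Variable R : realType.
Implicit Types (x y w phi : R) (f g : nat -> R).

Lemma cos_lipschitz x y : `|cos y - cos x| <= `|y - x|.
Proof.
rewrite -[leRHS]mul1r.
apply: (@derivative_bound_lipschitz _ cos (fun z => - sin z)) => z.
by rewrite normrN sin_max.
Qed.

(** The phases 0 and pi / 2 control all the others, so a union bound over phases involves only two;
    [x + 0] keeps both terms in the shape of a phase. *)
Lemma cos_phase_decomp x phi :
  cos (x + phi) = cos phi * cos (x + 0) + sin phi * cos (x + pi / 2).
Proof. by rewrite !cosD cos0 sin0 cos_pihalf sin_pihalf; ring. Qed.

Lemma sin_ge_half x : 0 <= x <= 1 / 2 -> x / 2 <= sin x.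
Proof.
move=> /andP[x0 x1].
have [c cx] := MVT_between 0 x (@is_derive_sin R).
rewrite sin0 !subr0 in cx * => ->; rewrite mulrC ler_wpM2r//.
have := cos_lipschitz 0 c; rewrite cos0 subr0 ler_norml => /andP[+ _].
have : `|c| <= 1 / 2 by apply: le_trans cx _; rewrite ger0_norm.
lra.
Qed.

(** Multiplication by 2 sin(th / 2) telescopes the sum into a difference of two sines, and sin(th /
    2) >= th / 4 for th <= 1. *)
Lemma sum_cos_arith_bound (M : nat) x (th : R) : 0 < th <= 1 ->
  `|\sum_(v < M) cos (x + v%:R * th)| <= 4 / th.
Proof.
move=> /andP[th0 th1].
have s0 : th / 4 <= sin (th / 2).
  have -> : th / 4 = (th / 2) / 2 by field.
  by apply: sin_ge_half; apply/andP; split; lra.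
have E : (2 * sin (th / 2)) * \sum_(v < M) cos (x + v%:R * th) =
    sin (x + (M%:R - 1 / 2) * th) - sin (x - th / 2).
  elim: M => [|M IH].
    by rewrite big_ord0 mulr0 (_ : x + (0 - 1 / 2) * th = x - th / 2) ?subrr//; field.
  rewrite big_ord_recr/= mulrDr IH (_ : M.+1%:R = M%:R + 1); last by rewrite natr1.
  have -> : x + (M%:R - 1 / 2) * th = (x + M%:R * th) - th / 2 by field.
  have -> : x + (M%:R + 1 - 1 / 2) * th = (x + M%:R * th) + th / 2 by field.
  move: (x + M%:R * th) (sin (x - th / 2)) => X c.
  by rewrite sinB sinD; ring.
have P : 0 < 2 * sin (th / 2) by lra.
have : `|(2 * sin (th / 2)) * \sum_(v < M) cos (x + v%:R * th)| <= 2.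
  rewrite E; apply: le_trans (ler_normB _ _) _.
  by have := sin_max (x + (M%:R - 1 / 2) * th); have := sin_max (x - th / 2); lra.
rewrite normrM gtr0_norm// -ler_pdivlMl//; move/le_trans; apply.
by rewrite ler_pdivrMl// mulrA ler_pdivlMr//; lra.
Qed.

Definition word_mean m f : R := 2^-1 ^+ m * \sum_(k < 2 ^ m) f k.

Lemma word_mean_le m f (B : R) :
  (forall k, (k < 2 ^ m)%N -> f k <= B) -> word_mean m f <= B.
Proof.
move=> fB; rewrite /word_mean exprVn ler_pdivrMl ?exprn_gt0//.
apply: le_trans (ler_sum _ (fun (k : 'I_(2 ^ m)) _ => fB k (ltn_ord k))) _.
by rewrite sumr_const card_ord -natrX mulr_natl.
Qed.

Lemma word_mean_norm_le m f (B : R) :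
  (forall k, (k < 2 ^ m)%N -> `|f k| <= B) -> `|word_mean m f| <= B.
Proof.
move=> fB; have N : - word_mean m f = word_mean m (fun k => - f k).
  by rewrite /word_mean sumrN mulrN.
rewrite ler_norml lerNl N; apply/andP; split; apply: word_mean_le => k kn;
  by have := fB k kn; rewrite ler_norml => /andP[]; lra.
Qed.

Lemma word_mean_lin m f g (a : R) :
  word_mean m (fun k => f k + a * g k) = word_mean m f + a * word_mean m g.
Proof. by rewrite /word_mean big_split/= -mulr_sumr; ring. Qed.

Lemma word_meanZ m f (a : R) : word_mean m (fun k => a * f k) = a * word_mean m f.
Proof. by rewrite /word_mean -mulr_sumr mulrCA. Qed.

Lemma eq_word_mean m f g : (forall k, (k < 2 ^ m)%N -> f k = g k) ->
  word_mean m f = word_mean m g.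
Proof. by move=> fg; rewrite /word_mean; congr (_ * _); apply: eq_bigr => k _; exact: fg. Qed.

Lemma word_mean_sum m (I : Type) (r : seq I) (F : I -> nat -> R) :
  word_mean m (fun k => \sum_(i <- r) F i k) = \sum_(i <- r) word_mean m (F i).
Proof. by rewrite /word_mean exchange_big/= mulr_sumr. Qed.

Lemma word_mean0 f : word_mean 0 f = f 0%N.
Proof. by rewrite /word_mean expr0 mul1r expn0 big_ord1. Qed.

Lemma word_meanS m f : word_mean m.+1 f =
  (word_mean m (fun k => f k.*2) + word_mean m (fun k => f k.*2.+1)) / 2.
Proof.
have E n : \sum_(k < n.*2) f k = \sum_(k < n) f k.*2 + \sum_(k < n) f k.*2.+1.
  by elim: n => [|n IH]; rewrite ?big_ord0 ?addr0// doubleS !big_ord_recr/= IH; ring.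
by rewrite /word_mean expnS mul2n E exprS -mulrDr; field.
Qed.

(** Its m-th power is 2^(-m/2), the scale of the fluctuation of a mean of 2^m independent bounded
    terms. *)
Definition half_root : R := Num.sqrt (1 / 2).

Lemma half_root_gt0 : 0 < half_root.
Proof. by rewrite sqrtr_gt0; lra. Qed.

Lemma half_root_sqr m : (half_root ^+ m) ^+ 2 = 2^-1 ^+ m.
Proof. by rewrite exprAC sqr_sqrtr ?div1r//; lra. Qed.

Lemma half_root_le1 : half_root <= 1.
Proof.
by have := half_root_gt0; have := half_root_sqr 1; rewrite !expr1; nra.
Qed.

(** Twice the bound at one phase, one copy for each of the two basic phases. The first term is the
    exponential moment estimate with the logarithm of the net size; the second is the Lipschitz
    constant 6 times the mesh 2^-m. *)
Definition conc_err m (T : R) : R :=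
  8 * half_root ^+ m * (ln T + m%:R + 4) + 12 * 2^-1 ^+ m.

Section Concentration.
Variables (m M : nat) (b : nat -> R) (a T : R).
Hypotheses (M_gt0 : (0 < M)%N) (b_le2 : forall k, (k < 2 ^ m)%N -> 0 <= b k <= 2).
Hypotheses (a_01 : 0 <= a <= 1) (T_ge1 : 1 <= T).

Let pos k (v : nat) : R := b k + a * (v%:R / M%:R).

(** The expectation of the k-th term when its value is drawn uniformly from the grid of the v /
    M. *)
Definition value_mean w phi k : R := M%:R^-1 * \sum_(v < M) cos (w * pos k v + phi).

Definition deviation w phi k v : R := cos (w * pos k v + phi) - value_mean w phi k.

Let pos_le k v : (k < 2 ^ m)%N -> (v < M)%N -> `|pos k v| <= 3.
Proof.
move=> km vM; have /andP[b0 b2] := b_le2 km; have /andP[a0 a1] := a_01.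
have M0 : 0 < M%:R :> R by rewrite ltr0n.
have v0 : 0 <= v%:R / M%:R :> R by rewrite divr_ge0.
have v1 : v%:R / M%:R <= 1 :> R by rewrite ler_pdivrMr// mul1r ler_nat ltnW.
rewrite /pos ger0_norm; first by have := ler_pM a0 v0 a1 v1; lra.
by rewrite addr_ge0// mulr_ge0.
Qed.

Let M0 : 0 < M%:R :> R. Proof. by rewrite ltr0n. Qed.

Lemma value_mean_norm_le w phi k (B : R) :
  (forall v, (v < M)%N -> `|cos (w * pos k v + phi)| <= B) ->
  `|value_mean w phi k| <= B.
Proof.
move=> H; rewrite normrM gtr0_norm ?invr_gt0// ler_pdivrMl//.
apply: le_trans (ler_norm_sum _ _ _) _.
apply: le_trans (ler_sum _ (fun (v : 'I_M) _ => H v (ltn_ord v))) _.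
by rewrite sumr_const card_ord mulr_natl.
Qed.

Lemma deviation_le2 w phi k v : `|deviation w phi k v| <= 2.
Proof.
apply: le_trans (ler_normB _ _) _.
have := @value_mean_norm_le w phi k 1 (fun v _ => cos_max _).
by have := cos_max (w * pos k v + phi); lra.
Qed.

Lemma deviation_sum0 w phi k : \sum_(v < M) deviation w phi k v = 0.
Proof.
rewrite /deviation sumrB sumr_const card_ord /value_mean -[X in _ - X]mulr_natl.
by rewrite mulrA mulfV ?gt_eqF// mul1r subrr.
Qed.

Lemma deviation_lipschitz w w' phi k v : (k < 2 ^ m)%N -> (v < M)%N ->
  `|deviation w phi k v - deviation w' phi k v| <= 6 * `|w - w'|.
Proof.
move=> km vM.
have L u : (u < M)%N ->
    `|cos (w * pos k u + phi) - cos (w' * pos k u + phi)| <= 3 * `|w - w'|.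
  move=> uM; apply: le_trans (cos_lipschitz _ _) _.
  rewrite (_ : _ - _ = pos k u * (w - w')); last by ring.
  by rewrite normrM ler_wpM2r// pos_le.
have -> : deviation w phi k v - deviation w' phi k v =
    (cos (w * pos k v + phi) - cos (w' * pos k v + phi)) -
    M%:R^-1 * \sum_(u < M) (cos (w * pos k u + phi) - cos (w' * pos k u + phi)).
  by rewrite sumrB /deviation /value_mean; ring.
apply: le_trans (ler_normB _ _) _; apply: (@le_trans _ _ (3 * `|w - w'| + 3 * `|w - w'|)).
  apply: lerD; first exact: L.
  rewrite normrM gtr0_norm ?invr_gt0// ler_pdivrMl//.
  apply: le_trans (ler_norm_sum _ _ _) _.
  apply: le_trans (ler_sum _ (fun (u : 'I_M) _ => L u (ltn_ord u))) _.
  by rewrite sumr_const card_ord -[X in X <= _]mulr_natl.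
lra.
Qed.

Lemma deviation_phase_decomp w phi k v : deviation w phi k v =
  cos phi * deviation w 0 k v + sin phi * deviation w (pi / 2) k v.
Proof.
rewrite /deviation /value_mean cos_phase_decomp.
under eq_bigr do rewrite cos_phase_decomp.
by rewrite big_split/= -!mulr_sumr; ring.
Qed.

Lemma deviation_choice_net (n : nat) : (0 < n)%N -> exists q : nat -> nat,
  (forall k, (q k < M)%N) /\
  forall j phi, (j < n)%N -> phi = 0 \/ phi = pi / 2 ->
    `|word_mean m (fun k => deviation (j%:R * 2^-1 ^+ m) phi k (q k))| <=
    4 * half_root ^+ m * (ln (4 * n)%:R + 1 / 2).
Proof.
move=> n0.
have r0 : 0 < half_root ^+ m by rewrite exprn_gt0// half_root_gt0.
(* With this t the quantity 8 t^2 2^m is the constant 1/2, and dividing by t 2^m leaves the factor 4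
   [half_root ^+ m]. *)
pose t : R := half_root ^+ m / 4.
have t0 : 0 < t by rewrite divr_gt0.
have t1 : 4 * t <= 1.
  rewrite /t mulrC divfK ?gt_eqF// exprn_ile1//.
    exact: ltW half_root_gt0.
  exact: half_root_le1.
pose d (js : 'I_n * bool) (k : 'I_(2 ^ m)) (v : 'I_M) : R :=
  deviation (js.1%:R * 2^-1 ^+ m) (if js.2 then pi / 2 else 0) k v.
have V0 : (0 < #|'I_M|)%N by rewrite card_ord.
have J0 : (0 < #|{: 'I_n * bool}|)%N by rewrite card_prod card_ord card_bool muln_gt0 n0.
have [q qP] := @chernoff_choice R _ _ _ d t V0 J0
  (fun j k v => deviation_le2 _ _ _ _) (fun j k => deviation_sum0 _ _ _) t0 t1.
(* Codes k >= 2^m get the value 0, which is below M because M is positive. *)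
pose q' k := if insub k is Some i then nat_of_ord (q i) else 0%N.
exists q'; split => [k|j phi jn phiE]; first by rewrite /q'; case: insubP.
have [s sE] : exists s : bool, phi = if s then pi / 2 else 0.
  by case: phiE => ->; [exists false|exists true].
have := qP (Ordinal jn, s).
have -> : \sum_k d (Ordinal jn, s) k (q k) =
    \sum_(k < 2 ^ m) deviation (j%:R * 2^-1 ^+ m) phi k (q' k).
  apply: eq_bigr => k _; rewrite /d /= -sE /q'.
  by case: insubP => [i _ /val_inj ->//|]; rewrite ltn_ord.
rewrite !card_prod !card_ord card_bool natrX => H.
rewrite /word_mean normrM gtr0_norm ?exprn_gt0 ?invr_gt0//.
apply: le_trans (ler_wpM2l (_ : 0 <= _) H) _; first by rewrite exprn_ge0.
have -> : 8 * t ^+ 2 * 2 ^+ m = 1 / 2.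
  rewrite /t expr_div_n half_root_sqr exprVn.
  by field; rewrite expf_neq0.
rewrite (_ : (2 * (n * 2) = 4 * n)%N); last by rewrite mulnCA mulnC.
rewrite -half_root_sqr /t le_eqVlt; apply/orP; left; apply/eqP.
by field; rewrite expf_neq0// gt_eqF// half_root_gt0.
Qed.

Lemma ln_net_size (n : nat) : (0 < n)%N -> n%:R <= 2 * T * 2 ^+ m ->
  ln (4 * n)%:R <= ln T + m%:R + 3 :> R.
Proof.
move=> n0 nT; have T0 : 0 < T by apply: lt_le_trans T_ge1.
have ln2 : ln 2 <= 1 :> R by have := ln_sublinear (ltr0n R 2); have := @expR_ge1Dx R 1;
   rewrite -[X in _ -> _ -> _ <= X]expRK => E _; rewrite ler_ln ?posrE ?expR_gt0//; lra.
apply: (@le_trans _ _ (ln (T * 2 ^+ (m + 3)))).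
  rewrite ler_ln ?posrE ?ltr0n ?muln_gt0//; last by rewrite mulr_gt0// exprn_gt0.
  rewrite natrM exprD (_ : 2 ^+ 3 = 4 * 2 :> R); last by ring.
  by move: nT; lra.
rewrite lnM ?posrE ?exprn_gt0// lnXn// -[ln 2 *+ _]mulr_natr natrD.
have : ln 2 * (m%:R + 3) <= 1 * (m%:R + 3) :> R by rewrite ler_wpM2r// addr_ge0.
lra.
Qed.

(** The choice is made on a net of frequencies at the two basic phases; the Lipschitz bound extends
    it to every frequency up to T, and the phase decomposition to every phase. *)
Lemma phase_concentration : exists q : nat -> nat,
  (forall k, (q k < M)%N) /\
  forall w phi, 0 <= w <= T ->
    `|word_mean m (fun k => deviation w phi k (q k))| <= conc_err m T.
Proof.
have P2 : 0 < 2 ^+ m :> R by rewrite exprn_gt0.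
have r0 : 0 < half_root ^+ m by rewrite exprn_gt0// half_root_gt0.
(* The net consists of the multiples of 2^-m up to T; each w is compared with the multiple just
   below it. *)
pose n := (Num.truncn (T * 2 ^+ m)).+1.
have T0 : 0 < T by apply: lt_le_trans T_ge1.
have nT : n%:R <= 2 * T * 2 ^+ m.
  rewrite /n (_ : (Num.truncn (T * 2 ^+ m)).+1%:R =
    (Num.truncn (T * 2 ^+ m))%:R + 1); last by rewrite natr1.
  have : (Num.truncn (T * 2 ^+ m))%:R <= T * 2 ^+ m by rewrite truncn_le mulr_ge0// ltW.
  have : 1 <= T * 2 ^+ m by rewrite mulr_ege1// exprn_ege1// ler1n.
  lra.
have [q [qM qP]] := @deviation_choice_net n isT.
exists q; split => // w phi /andP[w0 wT].
pose j := Num.truncn (w * 2 ^+ m).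
have jn : (j < n)%N by rewrite ltnS; apply: le_truncn; rewrite ler_pM2r.
have jw : `|w - j%:R * 2^-1 ^+ m| <= 2^-1 ^+ m.
  have /andP[j1 j2] : j%:R <= w * 2 ^+ m < j.+1%:R by rewrite truncn_itv// mulr_ge0// ltW.
  rewrite (_ : j.+1%:R = j%:R + 1) in j2; last by rewrite natr1.
  rewrite exprVn ger0_norm; last by rewrite subr_ge0 ler_pdivrMr.
  by rewrite lerBlDr -{1}[2 ^- m]mul1r -mulrDl ler_pdivlMr// addrC ltW.
have D1 phi0 : phi0 = 0 \/ phi0 = pi / 2 ->
    `|word_mean m (fun k => deviation w phi0 k (q k))| <=
    4 * half_root ^+ m * (ln T + m%:R + 4) + 6 * 2^-1 ^+ m.
  move=> phi0E.
  have -> : word_mean m (fun k => deviation w phi0 k (q k)) =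
      word_mean m (fun k => deviation (j%:R * 2^-1 ^+ m) phi0 k (q k)) +
      1 * word_mean m (fun k => deviation w phi0 k (q k) -
                            deviation (j%:R * 2^-1 ^+ m) phi0 k (q k)).
    by rewrite -word_mean_lin; apply: eq_word_mean => k _; ring.
  apply: le_trans (ler_normD _ _) _; rewrite mul1r; apply: lerD.
    apply: le_trans (qP j phi0 jn phi0E) _; rewrite ler_pM2l ?mulr_gt0//.
    by have := @ln_net_size n isT nT; lra.
  apply: word_mean_norm_le => k km.
  apply: le_trans (deviation_lipschitz _ _ _ km (qM k)) _.
  by rewrite ler_pM2l.
rewrite (@eq_word_mean _ _ (fun k => cos phi * deviation w 0 k (q k) +
   sin phi * deviation w (pi / 2) k (q k))); last first.
  by move=> k _; exact: deviation_phase_decomp.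
rewrite word_mean_lin.
rewrite word_meanZ.
apply: le_trans (ler_normD _ _) _.
rewrite (normrM (cos phi)) (normrM (sin phi)).
have A := D1 0 (or_introl erefl); have B := D1 (pi / 2) (or_intror erefl).
have cA := ler_pM (normr_ge0 _) (normr_ge0 _) (cos_max phi) A.
have sB := ler_pM (normr_ge0 _) (normr_ge0 _) (sin_max phi) B.
apply: le_trans (lerD cA sB) _; rewrite /conc_err le_eqVlt; apply/orP; left.
by apply/eqP; ring.
Qed.

(* One step of the construction: a perturbation of size [a] can be chosen so that
   the exponential sum neither grows at the frequencies already under control,
   nor is large at the frequencies [w] for which [w * a] is large. *)
Lemma phase_step : exists q : nat -> R,
  (forall k, 0 <= q k <= 1) /\
  forall w phi, 0 <= w <= T ->
  (forall s : R,
    (forall phi', `|word_mean m (fun k => cos (w * b k + phi'))| <= s) ->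
    `|word_mean m (fun k => cos (w * (b k + a * q k) + phi))| <= s + conc_err m T) /\
  (0 < w * a <= M%:R ->
    `|word_mean m (fun k => cos (w * (b k + a * q k) + phi))| <=
    4 / (w * a) + conc_err m T).
Proof.
have [q [qM qP]] := phase_concentration.
exists (fun k => (q k)%:R / M%:R); split => [k|w phi wT].
  by rewrite divr_ge0//= ler_pdivrMr// mul1r ler_nat ltnW.
(* Each term is its mean over the grid plus its deviation; the deviations are under control, so both
   claims reduce to bounds on the means. *)
have E (s : R) : `|word_mean m (value_mean w phi)| <= s ->
    `|word_mean m (fun k => cos (w * (b k + a * ((q k)%:R / M%:R)) + phi))| <=
    s + conc_err m T.
  move=> H; rewrite (@eq_word_mean _ _
    (fun k => value_mean w phi k + 1 * deviation w phi k (q k))); last first.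
    by move=> k _; rewrite /deviation mul1r [RHS]addrC subrK.
  rewrite word_mean_lin mul1r; apply: le_trans (ler_normD _ _) _.
  by apply: lerD => //; exact: qP.
split => [s sP|/andP[wa0 waM]]; apply: E.
  (* For a fixed grid value v, the perturbation shifts all words by the same phase w a v / M, so the
     assumption at all phases applies to each v. *)
  have -> : word_mean m (value_mean w phi) = M%:R^-1 *
      \sum_(v < M) word_mean m (fun k => cos (w * pos k v + phi)).
    rewrite /value_mean -word_mean_sum /word_mean mulrCA; congr (_ * _).
    by rewrite -mulr_sumr.
  rewrite normrM gtr0_norm ?invr_gt0// ler_pdivrMl//.
  apply: le_trans (ler_norm_sum _ _ _) _.
  rewrite mulr_natl -[X in _ *+ X]card_ord -sumr_const; apply: ler_sum => v _.
  rewrite (@eq_word_mean _ _ (fun k => cos (w * b k + (w * a * (v%:R / M%:R) + phi)))).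
    exact: sP.
  by move=> k _; congr cos; rewrite /pos; ring.
apply: word_mean_norm_le => k km.
rewrite normrM gtr0_norm ?invr_gt0// ler_pdivrMl//.
(* For a single word the grid values form an arithmetic progression of phases with this step; the
   bound w a <= M keeps the step below 1. *)
have th : 0 < w * a / M%:R <= 1 by rewrite divr_gt0//= ler_pdivrMr// mul1r.
have := @sum_cos_arith_bound M (w * b k + phi) _ th.
rewrite (_ : 4 / (w * a / M%:R) = M%:R * (4 / (w * a))); last first.
  have := gt_eqF wa0; rewrite mulf_eq0 => /negbT; rewrite negb_or => /andP[w_n0 a_n0].
  by field; rewrite w_n0 a_n0 gt_eqF.
congr (_ <= _); congr `|_|; apply: eq_bigr => v _; congr cos.
by rewrite /pos; field; rewrite gt_eqF.
Qed.

End Concentration.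

End Phases.

(** * Scales and the choice of the perturbation *)

(** As x passes to 3x/4, the reserve 3Kx drops by exactly K (3x/4), which pays for the error e of
    that step. *)
Lemma geometric_budget (R : realType) (K e x y : R) : e <= K * (3 / 4 * x) ->
  y - 3 * K * x + e <= y - 3 * K * (3 / 4 * x).
Proof. by lra. Qed.

Section Scales.
Variables (R : realType) (theta lam delta : R).
Hypotheses (theta_gt0 : 0 < theta) (theta_lt1 : theta < 1).
Hypotheses (lam_gt0 : 0 < lam) (lam_lt : lam < 1 / 2) (delta_gt0 : 0 < delta).

Definition log_scale n : R := n%:R `^ theta^-1.

Definition scale n : R := expR (log_scale n).

(** The factor 4^n makes w a_n >= delta 4^n once w >= [scale n], so the oscillation bound 4 / (w
    a_n) is geometrically small. *)
Definition amplitude n : R := delta * 4 ^+ n / scale n.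

Lemma log_scale_ge0 n : 0 <= log_scale n.
Proof. exact: powR_ge0. Qed.

Lemma scale_gt0 n : 0 < scale n.
Proof. exact: expR_gt0. Qed.

Lemma scale_ge1 n : 1 <= scale n.
Proof. by rewrite -expR0 ler_expR log_scale_ge0. Qed.

Lemma log_scale_le n n' : (n <= n')%N -> log_scale n <= log_scale n'.
Proof.
move=> nn'; apply: ge0_ler_powR; rewrite ?nnegrE ?ler_nat//.
by rewrite invr_ge0 ltW.
Qed.

Lemma scale_le n n' : (n <= n')%N -> scale n <= scale n'.
Proof. by move=> nn'; rewrite ler_expR log_scale_le. Qed.

Lemma amplitude_gt0 n : 0 < amplitude n.
Proof. by rewrite divr_gt0 ?scale_gt0// mulr_gt0// exprn_gt0. Qed.

(** As theta < 1, n^(1/theta) exceeds n ln(2A) once n >= N0 = ln(2A)^(1/(1/theta - 1)); below N0 the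
    constant exp(N0 ln(2A)) absorbs the loss. *)
Lemma geometric_div_scale (A : R) : 1 <= A -> exists2 K : R, 0 < K &
  forall n, A ^+ n / scale n <= K * 2^-1 ^+ n.
Proof.
move=> A1; have A0 : 0 < 2 * A by lra.
pose c := ln (2 * A).
have c0 : 0 <= c by apply: ln_ge0; lra.
have s1 : 0 < theta^-1 - 1 by rewrite subr_gt0 invf_gt1.
pose N0 := c `^ (theta^-1 - 1)^-1.
exists (expR (N0 * c)) => [|n]; first exact: expR_gt0.
have -> : A ^+ n / scale n = (2 * A) ^+ n / scale n * 2^-1 ^+ n.
  by rewrite mulrAC -exprMn mulrAC divff ?mul1r.
rewrite ler_pM2r ?exprn_gt0 ?invr_gt0// -[2 * A]lnK ?posrE// -expRM_natl.
rewrite /scale -expRN -expRD ler_expR -/c.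
have [nN|Nn] := ltP n%:R N0.
  have := log_scale_ge0 n; have : n%:R * c <= N0 * c by rewrite ler_wpM2r// ltW.
  lra.
have cn : c <= n%:R `^ (theta^-1 - 1).
  have <- : N0 `^ (theta^-1 - 1) = c by rewrite /N0 -powRrM mulVf ?gt_eqF// powRr1.
  by apply: ge0_ler_powR => //; rewrite ?nnegrE ?powR_ge0// ltW.
have : n%:R * c <= log_scale n.
  rewrite /log_scale -mulr_powRB1 ?invr_gt0//.
  by rewrite ler_wpM2l.
have : 0 <= N0 * c by rewrite mulr_ge0// powR_ge0.
lra.
Qed.

Lemma poly_le_geometric (d : nat) (g : R) : 1 < g -> exists2 K : R, 0 <= K &
  forall m, m.+1%:R ^+ d <= K * g ^+ m.
Proof.
move=> g1; have g0 : 0 < g by lra.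
have lg : 0 < ln g by exact: ln_gt0.
exists (d`!%:R * g / ln g ^+ d) => [|m].
  by rewrite divr_ge0// ?mulr_ge0 ?exprn_ge0// ltW.
rewrite mulrAC ler_pdivlMr ?exprn_gt0// -exprMn.
apply: le_trans (exprn_le_expR d _) _; first by rewrite mulr_ge0// ltW.
by rewrite expRM_natl lnK ?posrE// exprS mulrA.
Qed.

(** The logarithm of [scale m.+1] is bounded by a power of m + 1. Since sqrt(1/2) < 3/4, the ratio g
    of these numbers exceeds 1 and g^m absorbs that power. *)
Lemma conc_err_scale : exists2 K : R, 0 <= K &
  forall m, conc_err m (scale m.+1) <= K * (3 / 4) ^+ m.
Proof.
have r0 := half_root_gt0 R.
have r34 : half_root R < 3 / 4.
  by have := half_root_sqr R 1; rewrite !expr1; nra.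
pose g := 3 / 4 / half_root R.
have g1 : 1 < g by rewrite ltr_pdivlMr// mul1r.
pose d := (Num.truncn theta^-1).+1.
have [K K0 HK] := poly_le_geometric d g1.
exists (40 * K + 12) => [|m]; first by lra.
have Lm : log_scale m.+1 <= m.+1%:R ^+ d.
  rewrite /log_scale -powR_mulrn//; apply: ler_powR; first by rewrite ler1n.
  by rewrite ltW// truncnS_gt.
have m4 : m%:R + 4 <= 4 * m.+1%:R ^+ d :> R.
  apply: (@le_trans _ _ (4 * m.+1%:R)).
    by rewrite -[m.+1%:R]natr1; have := ler0n R m; lra.
  by rewrite ler_pM2l// -[X in X <= _]expr1 ler_weXn2l// ler1n.
rewrite /conc_err /scale expRK.
have E : half_root R ^+ m * g ^+ m = (3 / 4) ^+ m.
  by rewrite -exprMn /g mulrC divfK// gt_eqF.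
have rm : 0 <= half_root R ^+ m by rewrite exprn_ge0// ltW.
have H : half_root R ^+ m * (log_scale m.+1 + m%:R + 4) <=
    5 * K * (3 / 4) ^+ m.
  rewrite -E mulrCA; apply: le_trans (_ : half_root R ^+ m * (5 * (K * g ^+ m)) <= _).
    by rewrite ler_wpM2l//; have := HK m; lra.
  by rewrite le_eqVlt; apply/orP; left; apply/eqP; ring.
have P : (2^-1 : R) ^+ m <= (3 / 4) ^+ m by rewrite lerXn2r ?nnegrE//; lra.
by lra.
Qed.

Section Heights.
Variable q : nat -> nat -> R.

(** The value at the left end of cylinder k of the identity plus the perturbations of levels 1 to n;
    level 0 carries no perturbation. *)
Fixpoint height n k : R :=
  if n is n'.+1 then
    height n' k./2 + (odd k)%:R * ((1 - lam) * lam ^+ n') + amplitude n * q n k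
  else 0.

End Heights.

Hypothesis amplitude_le : forall n, amplitude n <= 2^-1 ^+ n.

(** The bounds on b are a premise inside the property, so that a suitable q exists for every b and
    can be selected by [choice] before the heights are known to satisfy them. *)
Definition controlled_step m (b q : nat -> R) :=
  (forall k, 0 <= q k <= 1) /\
  ((forall k, (k < 2 ^ m)%N -> 0 <= b k <= 2) ->
   forall w phi, 0 <= w <= scale m.+1 ->
   (forall s : R,
     (forall phi', `|word_mean m (fun k => cos (w * b k + phi'))| <= s) ->
     `|word_mean m (fun k => cos (w * (b k + amplitude m * q k) + phi))| <=
       s + conc_err m (scale m.+1)) /\
   (0 < w ->
     `|word_mean m (fun k => cos (w * (b k + amplitude m * q k) + phi))| <=
       4 / (w * amplitude m) + conc_err m (scale m.+1))).

Lemma exists_controlled_step m b : exists q, controlled_step m b q.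
Proof.
have [bP|nbP] := pselect (forall k, (k < 2 ^ m)%N -> 0 <= b k <= 2); last first.
  by exists (fun=> 0); split => // k; rewrite lexx ler01.
have a01 : 0 <= amplitude m <= 1.
  rewrite ltW ?amplitude_gt0//=; apply: le_trans (amplitude_le m) _.
  by rewrite exprn_ile1//; lra.
(* The grid is fine enough that w a <= M for every frequency w up to [scale m.+1]. *)
pose M := (Num.truncn (scale m.+1 * amplitude m)).+1.
have [q [q01 qP]] := phase_step (isT : (0 < M)%N) bP a01 (scale_ge1 m.+1).
exists q; split => // _ w phi wT; have [A B] := qP w phi wT.
split => // w0; apply: B; rewrite mulr_gt0 ?amplitude_gt0//=.
apply: le_trans (ltW (truncnS_gt _)).
by case/andP: wT => _ wT; rewrite ler_pM2r// amplitude_gt0.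
Qed.

Lemma cylinder_left_bounds n k : 0 <= cylinder_left lam n k <= 1 - lam ^+ n.
Proof.
have [l0 l1] := (lam_gt0, lam_lt).
elim: n k => [|n IH] k /=; first by rewrite expr0 subrr lexx.
have /andP[a b] := IH k./2.
have ln : 0 < lam ^+ n by rewrite exprn_gt0.
have t0 : 0 <= (1 - lam) * lam ^+ n by rewrite mulr_ge0 ?ltW//; lra.
rewrite exprS; case: (odd k) => /=; rewrite ?mul1r ?mul0r ?addr0; apply/andP; split => //.
- by rewrite addr_ge0.
- by lra.
- by lra.
Qed.

(** The term 1 - 2^-n is the sum of the bounds 2^-j on the amplitudes of levels 1 to n. It keeps the
    heights in [0, 2], uniformly in n, as the concentration estimate demands. *)
Lemma height_bounds q n k : (forall n k, 0 <= q n k <= 1) ->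
  cylinder_left lam n k <= height q n k <= cylinder_left lam n k + 1 - 2^-1 ^+ n.
Proof.
move=> q01; elim: n k => [|n IH] k /=.
  by rewrite expr0 add0r subrr lexx.
have /andP[a b] := IH k./2; have /andP[c d] := q01 n.+1 k.
have A := amplitude_le n.+1; have A0 := amplitude_gt0 n.+1.
have e0 : 0 <= amplitude n.+1 * q n.+1 k by rewrite mulr_ge0// ltW.
have e1 : amplitude n.+1 * q n.+1 k <= 2^-1 ^+ n.+1.
  by apply: le_trans A; rewrite ler_piMr// ltW.
have E : (2^-1 : R) ^+ n = 2 * 2^-1 ^+ n.+1 by rewrite exprS; field.
apply/andP; split; lra.
Qed.

(** The height of a word of length n + 1 before its own perturbation; it serves as b in the step
    that chooses [q n.+1]. *)
Definition base_height q n k : R :=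
  height q n k./2 + (odd k)%:R * ((1 - lam) * lam ^+ n).

Lemma base_height_bounds q n k : (forall n k, 0 <= q n k <= 1) ->
  0 <= base_height q n k <= 2.
Proof.
move=> q01; have /andP[a b] := height_bounds n k./2 q01.
have /andP[c d] := cylinder_left_bounds n.+1 k; rewrite /= in c d.
rewrite /base_height.
have : 0 < lam ^+ n.+1 by rewrite exprn_gt0.
have : 0 < (2^-1 : R) ^+ n by rewrite exprn_gt0// invr_gt0.
by move=> *; apply/andP; split; lra.
Qed.

Lemma exists_controlled_words : exists q : nat -> nat -> R,
  (forall n k, 0 <= q n k <= 1) /\
  forall n, controlled_step n.+1 (base_height q n) (q n.+1).
Proof.
have [Q QP] := choice (fun mb : nat * (nat -> R) =>
  exists_controlled_step mb.1 mb.2).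
pose next n (H : nat -> R) k := H k./2 + (odd k)%:R * ((1 - lam) * lam ^+ n).
(* The values of level n + 1 depend on the heights of level n, which depend on earlier values;
   recursing on the heights and reading q off afterwards breaks the circle. *)
pose H := fix H n := if n is n'.+1 then
  (fun k => next n' (H n') k + amplitude n * Q (n, next n' (H n')) k) else fun=> 0.
pose q n := if n is n'.+1 then Q (n, next n' (H n')) else fun=> 0.
have HE n k : height q n k = H n k.
  by elim: n k => //= n IH k; rewrite IH.
exists q; split => [[|n] k|n]; first by rewrite lexx ler01.
  by have [+ _] := QP (n.+1, next n (H n)); exact.
have -> : base_height q n = next n (H n).
  by apply/funext => k; rewrite /base_height HE.
exact: QP (n.+1, next n (H n)).
Qed.

Definition phase_sum q n (w phi : R) : R :=
  word_mean n (fun k => cos (w * height q n k + phi)).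

(** For w between [scale n.+1] and [scale n.+2], level n + 1 makes the sum small by oscillation, and
    every later level adds only its concentration error. *)
Lemma exists_perturbation : exists q : nat -> nat -> R,
  (forall n k, 0 <= q n k <= 1) /\
  exists2 C : R, 0 < C & forall n j w phi, (n < j)%N ->
    scale n.+1 <= w <= scale n.+2 -> `|phase_sum q j w phi| <= C * (3 / 4) ^+ n.
Proof.
have [q [q01 qP]] := exists_controlled_words.
exists q; split => //.
have [K K0 HK] := conc_err_scale.
have step n w (s : R) : 0 <= w <= scale n.+2 ->
    (forall phi, `|phase_sum q n w phi| <= s) ->
    forall phi, `|phase_sum q n.+1 w phi| <= s + conc_err n.+1 (scale n.+2).
  move=> wT sP phi; have [_ QP] := qP n.
  have := (QP (fun k _ => base_height_bounds n k q01) w phi wT).1 s; apply => phi'.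
  (* The even and odd children each give the level-n sum, the odd ones with an extra phase w (1 -
     lam) lam^n; this is why the assumption covers all phases. *)
  rewrite word_meanS.
  have -> : word_mean n (fun k => cos (w * base_height q n k.*2 + phi')) =
      phase_sum q n w phi'.
    apply: eq_word_mean => k _.
    by rewrite /base_height odd_double doubleK mul0r addr0.
  have -> : word_mean n (fun k => cos (w * base_height q n k.*2.+1 + phi')) =
      phase_sum q n w (w * ((1 - lam) * lam ^+ n) + phi').
    apply: eq_word_mean => k _.
    rewrite /base_height -[k.*2.+1]/(true + k.*2)%N half_bit_double oddD odd_double.
    by rewrite /= mul1r mulrDr addrA.
  have A := sP phi'; have B := sP (w * ((1 - lam) * lam ^+ n) + phi').
  rewrite normrM [`|2^-1|]gtr0_norm ?invr_gt0//.
  apply: (@le_trans _ _ ((s + s) / 2)); last by lra.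
  rewrite ler_pM2r ?invr_gt0//; apply: le_trans (ler_normD _ _) _.
  exact: lerD.
have start n w : scale n.+1 <= w <= scale n.+2 ->
    forall phi, `|phase_sum q n.+1 w phi| <= (4 / delta + K) * (3 / 4) ^+ n.+1.
  move=> /andP[wn wn2] phi; have w0 : 0 < w := lt_le_trans (scale_gt0 _) wn.
  have wT : 0 <= w <= scale n.+2 by rewrite ltW.
  have [_ QP] := qP n.
  have /(_ w0) H := (QP (fun k _ => base_height_bounds n k q01) w phi wT).2.
  apply: le_trans H _; rewrite [leRHS]mulrDl; apply: lerD; last exact: HK.
  have wa : delta * 4 ^+ n.+1 <= w * amplitude n.+1.
    rewrite /amplitude mulrA ler_pdivlMr ?scale_gt0// mulrC ler_pM2r//.
    by rewrite mulr_gt0// exprn_gt0.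
  have d4 : 0 < delta * 4 ^+ n.+1 by rewrite mulr_gt0// exprn_gt0.
  apply: (@le_trans _ _ (4 / (delta * 4 ^+ n.+1))).
    by rewrite ler_pM2l// lef_pV2// posrE// (lt_le_trans d4).
  clear step qP HK QP.
  rewrite invfM mulrA ler_pM2l ?divr_gt0// -exprVn lerXn2r ?nnegrE//; lra.
have d0 : 0 < 4 / delta by rewrite divr_gt0.
exists (4 / delta + 4 * K + 1); first by lra.
move=> n j w phi nj wP; have /andP[wn wn2] := wP.
(* The subtracted term is the reserve for the errors of all levels still to come, a geometric tail
   of ratio 3/4. *)
suff H i : forall phi, `|phase_sum q (n.+1 + i) w phi| <=
    (4 / delta + 4 * K) * (3 / 4) ^+ n.+1 - 3 * K * (3 / 4) ^+ (n.+1 + i).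
  rewrite -(subnKC nj); apply: le_trans (H _ _) _.
  clear step start qP HK wP wn wn2.
  have p0 : 0 <= 3 * K * (3 / 4) ^+ (n.+1 + (j - n.+1)).
    by rewrite !mulr_ge0// exprn_ge0//; lra.
  have p1 : (3 / 4 : R) ^+ n.+1 <= (3 / 4) ^+ n.
    by apply: ler_wiXn2l => //; lra.
  have p2 : 0 < (3 / 4 : R) ^+ n by rewrite exprn_gt0//; lra.
  have p3 : (4 / delta + 4 * K) * (3 / 4) ^+ n.+1 <= (4 / delta + 4 * K) * (3 / 4) ^+ n.
    by rewrite ler_wpM2l//; lra.
  lra.
elim: i => {phi} [|i IH] phi.
  rewrite addn0; apply: le_trans (start n w wP phi) _.
  by rewrite le_eqVlt; apply/orP; left; apply/eqP; ring.
rewrite addnS; have wT : 0 <= w <= scale (n.+1 + i).+2.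
  rewrite (le_trans (ltW (scale_gt0 _)) wn)/=; apply: le_trans wn2 _.
  by apply: scale_le; rewrite !ltnS addSnnS leq_addr.
apply: le_trans (step _ _ _ wT IH phi) _.
have := HK (n.+1 + i).+1; rewrite [_ ^+ (n.+1 + i).+1]exprS.
exact: geometric_budget.
Qed.

End Scales.

(** * The perturbed map *)

Section CylinderGeometry.
Variables (R : realType) (lam : R).
Hypotheses (lam_gt0 : 0 < lam) (lam_lt : lam < 1 / 2).

Local Notation left := (cylinder_left lam).

(** Either the words are siblings, whose left ends differ by (1 - lam) times the parent's length, or
    their parents are distinct and already far enough apart. *)
Lemma cylinder_left_gap n k k' : (k < k')%N -> (k' < 2 ^ n)%N ->
  left n k + lam ^+ n * (1 + (1 - 2 * lam)) <= left n k'.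
Proof.
have [l0 l1] := (lam_gt0, lam_lt).
elim: n k k' => [|n IH] k k'; first by case: k' => // k' _; rewrite expn0 ltnS.
move=> kk' k'n /=.
have ln : 0 < lam ^+ n by rewrite exprn_gt0.
have lln : lam * lam ^+ n < 1 / 2 * lam ^+ n by rewrite ltr_pM2r.
have lln0 : 0 < lam * lam ^+ n by rewrite mulr_gt0.
have llln : lam * (lam * lam ^+ n) < 1 / 2 * (lam * lam ^+ n) by rewrite ltr_pM2r.
(* This is the slack in the sibling case: (1 - lam) lam^n minus the required 2 (1 - lam)
   lam^(n+1). *)
have nn : 0 <= (1 - 2 * lam) * (1 - lam) * lam ^+ n.
  by rewrite !mulr_ge0//; lra.
have h' : (k'./2 < 2 ^ n)%N by rewrite ltn_half_double -mul2n -expnS.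
have : (k./2 <= k'./2)%N by rewrite half_leq// ltnW.
rewrite exprS leq_eqVlt => /orP[/eqP E|/IH /(_ h') H].
  have [ok ok'] : odd k = false /\ odd k' = true.
    have : (odd k + k./2.*2 < odd k' + k'./2.*2)%N by rewrite !odd_double_half.
    by rewrite E ltn_add2r; case: (odd k); case: (odd k').
  by rewrite ok ok' E /= mul0r mul1r; lra.
case: (odd k); case: (odd k') => /=; rewrite ?mul0r ?mul1r; lra.
Qed.

Lemma cylinder_position n k k' (y : R) : (k < 2 ^ n)%N -> (k' < 2 ^ n)%N ->
  k <> k' -> 0 <= y <= 1 ->
  let z := (left n k + lam ^+ n * y - left n k') / lam ^+ n in
  z <= - (1 - 2 * lam) \/ 1 + (1 - 2 * lam) <= z.
Proof.
move=> kn k'n kk' /andP[y0 y1] z.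
have ln : 0 < lam ^+ n by rewrite exprn_gt0.
have zE : lam ^+ n * z = left n k + lam ^+ n * y - left n k'.
  by rewrite /z mulrC divfK// gt_eqF.
have ly : lam ^+ n * y <= lam ^+ n by rewrite ler_piMr// ltW.
have ly0 : 0 <= lam ^+ n * y by rewrite mulr_ge0// ltW.
case: (ltngtP k k') => // [lt|gt]; [left|right]; rewrite -(ler_pM2l ln) zE.
  by have := cylinder_left_gap lt k'n; lra.
by have := cylinder_left_gap gt kn; lra.
Qed.

End CylinderGeometry.

Section Perturbation.
Variables (R : realType) (theta lam : R) (B : R -> R).
Hypotheses (theta_gt0 : 0 < theta) (theta_lt1 : theta < 1).
Hypotheses (lam_gt0 : 0 < lam) (lam_lt : lam < 1 / 2).
Hypotheses (B_smooth : smooth B) (B1 : forall x, 0 <= x <= 1 -> B x = 1)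
  (B0 : forall x, x <= - (1 - 2 * lam) \/ 1 + (1 - 2 * lam) <= x -> B x = 0)
  (dB0 : forall x, 0 <= x <= 1 \/ x <= - (1 - 2 * lam) \/ 1 + (1 - 2 * lam) <= x ->
    derive1 B x = 0)
  (B_bounded : forall k, exists2 M, 0 <= M & forall x, `|derive1n k B x| <= M).

Local Notation left := (cylinder_left lam).

(** The j-th derivative of the perturbation of level n + 1; the shift of the index starts the series
    at level 1. *)
Definition layer (delta : R) (q : nat -> nat -> R) j n (x : R) : R :=
  amplitude theta delta n.+1 * \sum_(k < 2 ^ n.+1) q n.+1 k *
    ((lam ^+ n.+1)^-1 ^+ j * derive1n j B ((x - left n.+1 k) / lam ^+ n.+1)).

Lemma is_derive_layer delta q j n (x : R) :
  is_derive x 1 (layer delta q j n) (layer delta q j.+1 n x).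
Proof.
pose h k y : R := q n.+1 k *
  ((lam ^+ n.+1)^-1 ^+ j * derive1n j B ((y - left n.+1 k) / lam ^+ n.+1)).
pose dh k y : R := q n.+1 k *
  ((lam ^+ n.+1)^-1 ^+ j.+1 * derive1n j.+1 B ((y - left n.+1 k) / lam ^+ n.+1)).
have dhk (k : nat) : is_derive x 1 (h k) (dh k x).
  pose z y : R := (y - left n.+1 k) / lam ^+ n.+1.
  have dz : is_derive x 1 z (lam ^+ n.+1)^-1.
    apply: (@is_derive_quadratic _ _ _ 0) => y.
    by rewrite mul0r (_ : _ - _ - _ = 0) ?normr0// /z; ring.
  have dB := @is_derive1_comp _ (derive1n j B) z x _ _
    (derivable_is_derive (@smooth_derive1n _ B B_smooth j (z x))) dz.
  have := is_deriveZ (q n.+1 k * (lam ^+ n.+1)^-1 ^+ j) dB.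
  rewrite (_ : _ \*: _ = h k); last by apply/funext => y; rewrite /h mulrA.
  congr is_derive; rewrite /dh -/(z x) derive1nS (exprSr _ j) /GRing.scale /=; ring.
have dS : is_derive x 1 (\sum_(k < 2 ^ n.+1) h k) (\sum_(k < 2 ^ n.+1) dh k x).
  exact: is_derive_sum.
have := is_deriveZ (amplitude theta delta n.+1) dS.
rewrite (_ : _ \*: _ = layer delta q j n)//.
by apply/funext => y; rewrite /layer fct_sumE.
Qed.

(** Bounding all 2^(n+1) bumps together gives (8 lam^-j)^(n+1) / [scale n.+1], which decays faster
    than geometrically. C precedes delta and q because delta will be fixed from C for j = 1, and q
    only after delta. *)
Lemma layer_bound j : exists2 C : R, 0 <= C & forall delta q, 0 < delta ->
  (forall n k, 0 <= q n k <= 1) ->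
  forall y, geo_dominated (delta * C) (fun n => layer delta q j n y).
Proof.
have [M M0 BM] := B_bounded j.
have li : 1 <= lam^-1 by rewrite invf_ge1//; have := lam_lt; lra.
have lj : 1 <= lam^-1 ^+ j by rewrite exprn_ege1.
have A1 : 1 <= 8 * lam^-1 ^+ j by lra.
have [K K0 HK] := geometric_div_scale theta_gt0 theta_lt1 A1.
exists (K * M) => [|delta q d0 q01 y n]; first by rewrite mulr_ge0// ltW.
have a0 := amplitude_gt0 theta d0 n.+1.
have lnV : 0 < (lam ^+ n.+1)^-1 ^+ j by rewrite exprn_gt0// invr_gt0 exprn_gt0.
rewrite normrM gtr0_norm//.
apply: (@le_trans _ _ (amplitude theta delta n.+1 *
    (2 ^+ n.+1 * ((lam ^+ n.+1)^-1 ^+ j * M)))).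
  rewrite ler_pM2l//; apply: le_trans (ler_norm_sum _ _ _) _.
  rewrite -natrX mulr_natl -[X in _ *+ X]card_ord -sumr_const.
  apply: ler_sum => k _; have /andP[q0 q1] := q01 n.+1 k.
  rewrite normrM ger0_norm// -[leRHS]mul1r; apply: ler_pM => //.
  by rewrite normrM gtr0_norm// ler_pM2l.
have -> : amplitude theta delta n.+1 * (2 ^+ n.+1 * ((lam ^+ n.+1)^-1 ^+ j * M)) =
    delta * M * ((8 * lam^-1 ^+ j) ^+ n.+1 / scale theta n.+1).
  have -> : (8 : R) = 4 * 2 by ring.
  rewrite /amplitude !exprMn -exprVn (exprAC _ n.+1 j); ring.
have -> : delta * (K * M) * 2^-1 ^+ n = delta * M * (K * 2^-1 ^+ n) by ring.
apply: ler_wpM2l; first by rewrite mulr_ge0// ltW.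
apply: le_trans (HK _) _; rewrite ler_pM2l//.
by apply: ler_wiXn2l => //; lra.
Qed.

Variables (delta : R) (q : nat -> nat -> R).
Hypotheses (delta_gt0 : 0 < delta) (q01 : forall n k, 0 <= q n k <= 1).

Lemma layer_bounds : exists C : nat -> R,
  forall j y, geo_dominated (C j) (fun n => layer delta q j n y).
Proof.
suff H j : exists c, forall y, geo_dominated c (fun n => layer delta q j n y).
  by have [C CP] := choice H; exists C.
by have [C _ CP] := layer_bound j; exists (delta * C) => y; exact: CP.
Qed.

Definition perturbation (x : R) : R := sumR (fun n => layer delta q 0 n x).

Definition perturbed (x : R) : R := x + perturbation x.

Lemma is_derive_perturbed (x : R) :
  is_derive x 1 perturbed (1 + sumR (fun n => layer delta q 1 n x)).
Proof.
have [C CP] := layer_bounds.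
apply: is_deriveD.
apply: (@is_derive_sumR _ (layer delta q) C 0 x).
  by move=> k n y; exact: is_derive_layer.
by move=> k y; exact: CP.
Qed.

Lemma smooth_perturbed : smooth perturbed.
Proof.
have [C CP] := layer_bounds.
move=> n; apply: CkD; first exact: Ck_id.
apply: (@smooth_sumR _ (layer delta q) C).
  by move=> k m y; exact: is_derive_layer.
by move=> k y; exact: CP.
Qed.

Lemma layer0_on_cylinder n k (y : R) : (k < 2 ^ n.+1)%N -> 0 <= y <= 1 ->
  layer delta q 0 n (left n.+1 k + lam ^+ n.+1 * y) =
  amplitude theta delta n.+1 * q n.+1 k.
Proof.
move=> kn y01; rewrite /layer; congr (_ * _).
rewrite (bigD1 (Ordinal kn))//= big1 ?addr0 => [|k' k'k].
  rewrite expr0 mul1r addrAC subrr add0r mulrAC divff ?mul1r ?B1 ?mulr1//.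
  by rewrite expf_neq0// gt_eqF.
rewrite expr0 mul1r B0 ?mulr0//.
have neq : k <> k' by move=> E; move/eqP: k'k; apply; exact/val_inj.
exact: (cylinder_position lam_gt0 lam_lt kn (ltn_ord k') neq y01).
Qed.

Lemma layer1_on_cylinder n k (y : R) : (k < 2 ^ n.+1)%N -> 0 <= y <= 1 ->
  layer delta q 1 n (left n.+1 k + lam ^+ n.+1 * y) = 0.
Proof.
move=> kn y01; rewrite /layer big1 ?mulr0// => k' _.
rewrite derive1n1 dB0 ?mulr0//.
have [<-|kk'] := eqVneq k k'.
  left; rewrite addrAC subrr add0r mulrAC divff ?mul1r//.
  by rewrite expf_neq0// gt_eqF.
right; move/eqP: kk' => neq.
exact: (cylinder_position lam_gt0 lam_lt kn (ltn_ord k') neq y01).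
Qed.

Lemma partial_perturbed_on_cylinder m k (y : R) : (k < 2 ^ m)%N -> 0 <= y <= 1 ->
  let x := left m k + lam ^+ m * y in
  x + series (fun n => layer delta q 0 n x) m =
  height theta lam delta q m k + lam ^+ m * y.
Proof.
have [l0 l1] := (lam_gt0, lam_lt).
elim: m k y => [|m IH] k y km y01 /=.
  by rewrite /series/= big_geq// addr0.
have k2 : (k./2 < 2 ^ m)%N by rewrite ltn_half_double -mul2n -expnS.
(* The relative position of the same point in the parent cylinder, to which the induction hypothesis
   applies. *)
pose y' := lam * y + (odd k)%:R * (1 - lam).
have y'01 : 0 <= y' <= 1.
  have /andP[y0 y1] := y01.
  have : 0 <= lam * y by rewrite mulr_ge0// ltW.
  have : lam * y <= lam by rewrite ler_piMr// ltW.
  by rewrite /y'; case: (odd k) => /=; rewrite ?mul1r ?mul0r => *;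
    apply/andP; split; lra.
have E : left m k./2 + (odd k)%:R * ((1 - lam) * lam ^+ m) + lam ^+ m.+1 * y =
    left m k./2 + lam ^+ m * y' by rewrite /y' exprSr; ring.
have := layer0_on_cylinder km y01; rewrite /= E => L.
rewrite /series/= big_nat_recr//= addrA L.
have := IH _ _ k2 y'01; rewrite /series/= => ->.
rewrite /y' exprSr; ring.
Qed.

(** A point of the attractor lies in a cylinder of every level, where its own bump is on the plateau
    and the others vanish; so the derivative of each layer is 0. *)
Lemma derive1_perturbed_attractor x : cantor_attractor lam x ->
  derive1 perturbed x = 1.
Proof.
move=> Xx; rewrite derive1E; have := is_derive_perturbed x.
move=> /@derive_val ->; rewrite (_ : (fun _ => _) = fun=> 0); last first.
  apply/funext => n; have [k [y [kn Xy ->]]] := cantor_cylinder lam_gt0 lam_lt n.+1 Xx.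
  apply: layer1_on_cylinder => //.
  by have := Xy 0%N I; rewrite /= in_itv.
rewrite (_ : sumR _ = 0) ?addr0//; apply/eqP; rewrite -normr_le0.
have d0 : @geo_dominated R 0 (fun=> 0) by move=> n; rewrite normr0 mul0r.
by have := sumR_geo_bound d0; rewrite mulr0.
Qed.

Lemma derive1_perturbed_close (C : R) :
  (forall y, geo_dominated (delta * C) (fun n => layer delta q 1 n y)) ->
  delta * C <= 1 / 8 -> forall x, 3 / 4 <= derive1 perturbed x <= 5 / 4.
Proof.
move=> H C8 x; rewrite derive1E; have := is_derive_perturbed x.
move=> /@derive_val ->; have := sumR_geo_bound (H x).
by rewrite ler_norml => /andP[a b]; apply/andP; split; lra.
Qed.

Lemma perturbed_partial_error : exists2 K : R, 0 <= K & forall m x,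
  `|perturbed x - (x + series (fun n => layer delta q 0 n x) m)| <= K * 2^-1 ^+ m.
Proof.
have [C C0 CP] := layer_bound 0.
exists (2 * (delta * C)) => [|m x]; first by rewrite !mulr_ge0// ltW.
have D := CP delta q delta_gt0 q01 x.
have -> : perturbed x - (x + series (fun n => layer delta q 0 n x) m) =
    sumR (fun n => layer delta q 0 (m + n) x).
  rewrite /perturbed /perturbation opprD addrACA subrr add0r.
  apply/esym; rewrite /sumR; apply: cvg_lim => //.
  have -> : series (fun n => layer delta q 0 (m + n) x) =
      (fun n => series (fun n => layer delta q 0 n x) (n + m)%N -
                series (fun n => layer delta q 0 n x) m).
    apply/funext => n; rewrite sub_series_geq ?leq_addl// /series/=.
    by rewrite -{2}[m]add0n big_addn addnK; apply: eq_bigr => i _; rewrite addnC.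
  apply: cvgB; last exact: cvg_cst.
  by rewrite (cvg_shiftn m (series (fun n => layer delta q 0 n x))); exact: geo_dominated_cvg D.
rewrite -mulrA; apply: sumR_geo_bound => n.
by have := D (m + n)%N; rewrite exprD mulrA.
Qed.

End Perturbation.

(** * Reduction of the Fourier transform to exponential sums *)

Lemma continuous_cos_phase (R : realType) (G : R -> R) (w phi : R) :
  continuous G -> continuous (fun x => cos (w * G x + phi)).
Proof.
move=> cG x; apply: (@continuous_comp _ _ _ (fun x => w * G x + phi) cos).
  apply: continuousD; last exact: cvg_cst.
  by apply: continuousM; [exact: cvg_cst|exact: cG].
exact: continuous_cos.
Qed.

Section FourierReduction.
Variables (R : realType) (lam : R) (mu : probability (measurableTypeR R) R).
Hypotheses (lam_gt0 : 0 < lam) (lam_lt : lam < 1 / 2).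
Hypothesis mu_stationary : stationary (aff0 lam) (aff1 lam) mu.

Lemma Rintegral_close (f : R -> R) (M c e : R) : continuous f ->
  (forall x, `|f x| <= M) -> (forall x, 0 <= x <= 1 -> `|f x - c| <= e) ->
  `|Rintegral mu setT f - c| <= e.
Proof.
move=> cf fM fe; have [mu1 _] := mu_stationary.
have m01 : measurable (`[0, 1]%classic : set (measurableTypeR R)).
  exact: measurable_itv.
have muT (x : R) : fine (mu `[0, 1]%classic) * x = x by rewrite mu1 mul1r.
have iT := integrable_continuous_bounded mu cf fM.
have i01 : mu.-integrable `[0, 1]%classic (EFin \o f).
  exact: integrableS iT.
have ic (r : R) : mu.-integrable `[0, 1]%classic (EFin \o fun=> r).
  apply: (integrableS measurableT) => //.
  apply: (@integrable_continuous_bounded R mu (fun=> r) `|r|) => //.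
  by move=> x; exact: cvg_cst.
have N0 : mu (~` `[0, 1]%classic) = 0%E by rewrite probability_setC// mu1 subee.
have E : Rintegral mu setT f = Rintegral mu `[0, 1]%classic f.
  rewrite /Rintegral; congr fine.
  rewrite (negligible_integral (measurableC m01) measurableT iT N0).
  by rewrite setDE setTI setCK.
have cE (r : R) : Rintegral mu `[0, 1]%classic (fun=> r) = r.
  by rewrite Rintegral_cst// mulrC; exact: muT.
rewrite E -[X in _ - X]cE -RintegralB//.
have iB : mu.-integrable `[0, 1]%classic (EFin \o (fun x => f x - c)).
  rewrite (_ : _ \o _ = (EFin \o f) \- (EFin \o fun=> c))%E//.
  exact: integrableB.
apply: le_trans (le_normr_Rintegral m01 iB) _.
rewrite -[leRHS]cE; apply: le_Rintegral => //.
exact: integrable_norm iB.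
Qed.

Lemma Rintegral_cylinders (f : R -> R) (M : R) m : continuous f ->
  (forall x, `|f x| <= M) ->
  Rintegral mu setT f = word_mean m (fun k =>
    Rintegral mu setT (fun x => f (cylinder_left lam m k + lam ^+ m * x))).
Proof.
move=> cf fM; elim: m => [|m IH].
  rewrite word_mean0; congr Rintegral.
  by apply/funext => x; rewrite /= add0r mul1r.
have cA k : continuous (fun x => f (cylinder_left lam m k + lam ^+ m * x)).
  move=> x; apply: continuous_comp; last exact: cf.
  apply: (@smooth_continuous R (fun x => cylinder_left lam m k + lam ^+ m * x)) => n.
  have := Ck_affine n (lam ^+ m) (cylinder_left lam m k).
  by congr Ck; apply/funext => y; rewrite addrC.
rewrite IH word_meanS.
have step k : Rintegral mu setT (fun x => f (cylinder_left lam m k + lam ^+ m * x)) =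
   2^-1 * Rintegral mu setT (fun x => f (cylinder_left lam m.+1 k.*2 + lam ^+ m.+1 * x)) +
   2^-1 * Rintegral mu setT (fun x => f (cylinder_left lam m.+1 k.*2.+1 + lam ^+ m.+1 * x)).
  rewrite (stationary_Rintegral (@continuous_aff0 _ lam) (@continuous_aff1 _ lam)
    mu_stationary (@cA k) (fun x => fM _)).
  rewrite mulrDl; congr (_ + _); rewrite mulrC; congr (_ * Rintegral _ _ _);
    apply/funext => x /=; congr f.
    by rewrite odd_double doubleK mul0r addr0 /aff0 exprSr mulrA.
  rewrite odd_double -[uphalf k.*2]/((true + k.*2)./2)%N half_bit_double.
  by rewrite mul1r /aff1 exprSr; ring.
under eq_word_mean do rewrite step.
by rewrite word_mean_lin word_meanZ; field.
Qed.

Variables (q : nat -> nat -> R) (theta delta : R) (G : R -> R) (K : R).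
Hypothesis G_continuous : continuous G.
Hypothesis G_cylinder : forall m k x, (k < 2 ^ m)%N -> 0 <= x <= 1 ->
  `|G (cylinder_left lam m k + lam ^+ m * x) - height theta lam delta q m k|
     <= K * 2^-1 ^+ m.

(** Iterated stationarity writes the integral as a mean over words; on each cylinder G is close to
    the height, and cos is 1-Lipschitz. *)
Lemma Rintegral_phase_sum m (w phi : R) : 0 <= w ->
  `|Rintegral mu setT (fun x => cos (w * G x + phi)) -
    phase_sum theta lam delta q m w phi| <= w * (K * 2^-1 ^+ m).
Proof.
move=> w0; pose f x := cos (w * G x + phi).
have cf : continuous f by exact: continuous_cos_phase.
have f1 x : `|f x| <= 1 by exact: cos_max.
rewrite -/f (Rintegral_cylinders m cf f1) /phase_sum.
pose I k := Rintegral mu setT (fun x => f (cylinder_left lam m k + lam ^+ m * x)).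
have -> : word_mean m I - word_mean m (fun k => cos (w * height theta lam delta q m k + phi)) =
  word_mean m (fun k => I k + (-1) * cos (w * height theta lam delta q m k + phi)).
  by rewrite word_mean_lin mulN1r.
apply: word_mean_norm_le => k km; rewrite mulN1r.
apply: (@Rintegral_close _ 1) => [x|x|x x01].
- apply: (@continuous_comp _ _ _ (fun x => cylinder_left lam m k + lam ^+ m * x) f).
    apply: (@smooth_continuous R (fun x => cylinder_left lam m k + lam ^+ m * x)) => n.
    have := Ck_affine n (lam ^+ m) (cylinder_left lam m k).
    by congr Ck; apply/funext => y; rewrite addrC.
  exact: cf.
- exact: cos_max.
- apply: le_trans (cos_lipschitz _ _) _.
  rewrite (_ : _ - _ = w * (G (cylinder_left lam m k + lam ^+ m * x) -
    height theta lam delta q m k)); last by ring.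
  by rewrite normrM ger0_norm// ler_wpM2l// G_cylinder.
Qed.

(** For fixed w the discretization error w K 2^-m tends to 0, so a bound uniform over the levels m >
    n survives in the limit. *)
Lemma Rintegral_phase_bound (w phi D : R) n : 0 <= w ->
  (forall j, (n < j)%N -> `|phase_sum theta lam delta q j w phi| <= D) ->
  `|Rintegral mu setT (fun x => cos (w * G x + phi))| <= D.
Proof.
move=> w0 H; set I := Rintegral _ _ _.
have c0 : D + w * K * 2^-1 ^+ m @[m --> \oo] --> D.
  rewrite -[X in _ --> X]addr0; apply: cvgD; first exact: cvg_cst.
  rewrite -[X in _ --> X](mulr0 (w * K)); apply: cvgMl_tmp.
  by apply: cvg_expr; rewrite ger0_norm; lra.
have le : \forall m \near \oo, `|I| <= D + w * K * 2^-1 ^+ m.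
  near=> m; have nm : (n < m)%N by near: m; exact: nbhs_infty_gt.
  have := Rintegral_phase_sum m phi w0; rewrite -/I => A.
  have := H m nm; have := ler_normD (I - phase_sum theta lam delta q m w phi)
    (phase_sum theta lam delta q m w phi).
  by rewrite subrK -mulrA; lra.
exact: (ler_cvg_to (cvg_cst _) c0 le).
Unshelve. all: by end_near. Qed.

End FourierReduction.

(** * Conjugation and decay *)

Section Conjugation.
Variables (R : realType) (lam : R) (h : R -> R) (c : R).
Hypotheses (lam_gt0 : 0 < lam) (lam_lt : lam < 1 / 2).
Hypotheses (h_smooth : smooth h) (c_gt0 : 0 < c).
Hypothesis h_derive : forall x, c <= derive1 h x.

Let dh (x : R) : is_derive x 1 h (derive1 h x).
Proof. by apply: derivable_is_derive; case: (h_smooth 1%N). Qed.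

Lemma expanding_le x y : x <= y -> c * (y - x) <= h y - h x.
Proof.
move=> xy; have [z _ ->] := MVT_between x y dh.
by rewrite ler_wpM2r// subr_ge0.
Qed.

Lemma expanding_lt x y : x < y -> h x < h y.
Proof.
move=> xy; rewrite -subr_gt0; apply: lt_le_trans (expanding_le (ltW xy)).
by rewrite mulr_gt0// subr_gt0.
Qed.

Lemma expanding_leE x y : (h x <= h y) = (x <= y).
Proof.
have [xy|yx] := leP x y; last by rewrite leNgt expanding_lt.
by move: xy; rewrite le_eqVlt => /predU1P[->|/expanding_lt/ltW]; rewrite ?lexx.
Qed.

Lemma expanding_inverse : exists g, cancel h g /\ cancel g h.
Proof.
have hI : injective h.
  by move=> x y E; apply/eqP; rewrite eq_le -(expanding_leE x y) -(expanding_leE y x) E lexx.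
have surj y : exists x, h x = y.
  (* Since h grows at rate at least c, the values at -X and X enclose y. *)
  pose X := `|y - h 0| / c.
  have X0 : 0 <= X by rewrite divr_ge0// ltW.
  have cX : c * X = `|y - h 0| by rewrite /X mulrC divfK// gt_eqF.
  have NX : - X <= X by lra.
  have A := expanding_le X0.
  have B : c * (0 - - X) <= h 0 - h (- X) by apply: expanding_le; lra.
  have ly := ler_norm (y - h 0); have ny := ler_norm (- (y - h 0)).
  rewrite normrN in ny.
  have hXX : h (- X) <= h X by rewrite expanding_leE.
  have cont : {within `[- X, X], continuous h}.
    by apply: continuous_subspaceT; exact: smooth_continuous.
  have [|x _ <-] := IVT NX cont (v := y); last by exists x.
  by rewrite (min_idPl hXX) (max_idPr hXX); apply/andP; split; lra.
have [g gP] := choice surj.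
by exists g; split => // x; apply: hI.
Qed.

Variable g : R -> R.
Hypotheses (hK : cancel h g) (gK : cancel g h).

Lemma smooth_inverse : smooth g.
Proof.
apply: (Ck_inverse hK gK h_smooth) => x.
by rewrite gt_eqF// (lt_le_trans c_gt0).
Qed.

Hypotheses (h0 : h 0 = 0) (h1 : h 1 = 1).

Lemma expanding_in01 x : (h x \in `[0, 1]) = (x \in `[0, 1]).
Proof. by rewrite !in_itv/= -{1}h0 -{1}h1 !expanding_leE. Qed.

Lemma inverse_in01 x : (g x \in `[0, 1]) = (x \in `[0, 1]).
Proof. by rewrite -expanding_in01 gK. Qed.

Lemma smooth_diffeo01_expanding : smooth_diffeo01 h.
Proof.
split => [x||]; first by rewrite expanding_in01.
  exact: smooth01_smooth.
exists g; split => [x||x _|x _] //; first by rewrite inverse_in01.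
exact/smooth01_smooth/smooth_inverse.
Qed.

Lemma is_derive_conj (e : R -> R) (y : R) :
  (forall x : R, is_derive x 1 e lam) ->
  is_derive y 1 (h \o e \o g) (derive1 h (e (g y)) * (lam * (derive1 h (g y))^-1)).
Proof.
move=> de.
have dg : is_derive y 1 g (derive1 h (g y))^-1.
  rewrite -{1}(gK y); apply: is_derive_inverse => //.
  - by near=> z; exact: hK.
  - by near=> z; exact: smooth_continuous.
  - by rewrite gt_eqF// (lt_le_trans c_gt0).
have deg := @is_derive1_comp _ e g y _ _ (de (g y)) dg.
exact: (@is_derive1_comp _ h (e \o g) y _ _ (dh (e (g y))) deg).
Unshelve. all: by end_near. Qed.

Lemma smooth_conj (e : R -> R) : smooth e -> smooth (h \o e \o g).
Proof.
move=> se n; apply: (@Ck_comp _ _ h (e \o g)); first exact: h_smooth.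
by apply: Ck_comp; [exact: se|exact: smooth_inverse].
Qed.

Lemma is_derive_aff0 (x : R) : is_derive x 1 (aff0 lam) lam.
Proof.
apply: (@is_derive_quadratic _ _ _ 0) => y.
by rewrite mul0r (_ : _ - _ - _ = 0) ?normr0// /aff0; ring.
Qed.

Lemma is_derive_aff1 (x : R) : is_derive x 1 (aff1 lam) lam.
Proof.
apply: (@is_derive_quadratic _ _ _ 0) => y.
by rewrite mul0r (_ : _ - _ - _ = 0) ?normr0// /aff1; ring.
Qed.

Hypothesis h_distortion : forall x y, derive1 h x <= 2 * derive1 h y.

(** A conjugated map has derivative lam times a quotient of two values of h'; the quotient is at
    most 2 and lam < 1/2. *)
Lemma hyperbolic_conj : hyperbolic_ifs (h \o aff0 lam \o g) (h \o aff1 lam \o g).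
Proof.
have [l0 l1] := (lam_gt0, lam_lt).
have g0 : g 0 = 0 by rewrite -{1}h0 hK.
have g1 : g 1 = 1 by rewrite -{1}h1 hK.
have bounds (e : R -> R) : (forall x : R, is_derive x 1 e lam) ->
    forall y, y \in `[0, 1] -> 0 < D01 (h \o e \o g) y < 1.
  move=> de y y01; have := is_derive_conj y de => D.
  have dd : derivable (h \o e \o g) y 1 by case: D.
  rewrite D01E// derive1E derive_val.
  have p1 := lt_le_trans c_gt0 (h_derive (e (g y))).
  have p2 := lt_le_trans c_gt0 (h_derive (g y)).
  rewrite !mulr_gt0 ?invr_gt0//= mulrA ltr_pdivrMr// mul1r.
  have : derive1 h (e (g y)) * lam < derive1 h (e (g y)) * (1 / 2) by rewrite ltr_pM2l.
  by have := h_distortion (e (g y)) (g y); lra.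
have in01 (e : R -> R) : (forall x, 0 <= x <= 1 -> 0 <= e x <= 1) ->
    maps01 (h \o e \o g).
  move=> H x x01 /=; rewrite expanding_in01 in_itv/=; apply: H.
  by rewrite -inverse_in01 in_itv in x01.
split.
- split; apply: in01 => x x01.
    by have /andP[a b] := aff0_01 lam_gt0 lam_lt x01; apply/andP; split; lra.
  by have /andP[a b] := aff1_01 lam_gt0 lam_lt x01; apply/andP; split; lra.
- split; apply: smooth01_smooth; apply: smooth_conj; [exact: smooth_aff0|exact: smooth_aff1].
- by move=> x x01; split; apply: bounds => //; [exact: is_derive_aff0|exact: is_derive_aff1].
- rewrite /= g0 g1 /aff0 /aff1 mulr0 h0 mulr1; split => //.
  by rewrite addrAC subrr add0r.
- by rewrite /= g0 g1 /aff0 /aff1; split; apply: expanding_lt; lra.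
Qed.

(** At a point h(x) with x in the attractor, both x and its image lie in the attractor, so the two
    values of h' in the chain rule are eta and cancel. *)
Lemma pseudo_affine_conj (eta : R) : 
  (forall x, cantor_attractor lam x -> derive1 h x = eta) ->
  pseudo_affine lam (h \o aff0 lam \o g) (h \o aff1 lam \o g).
Proof.
move=> hX; split; first exact: hyperbolic_conj.
have XA := is_attractor_cantor lam_gt0 lam_lt.
exists (h @` cantor_attractor lam); split.
  apply: is_attractor_conj => //.
  - exact: smooth_continuous.
  - by apply: smooth_continuous; exact: smooth_inverse.
  - by move=> x; rewrite expanding_in01.
  - by move=> x; rewrite inverse_in01.
have [[X01 _ _ XE] _] := XA.
have D (e : R -> R) x : (forall x : R, is_derive x 1 e lam) ->
    cantor_attractor lam x -> cantor_attractor lam (e x) ->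
    D01 (h \o e \o g) (h x) = lam.
  move=> de Xx Xe; have := is_derive_conj (h x) de => D.
  have dd : derivable (h \o e \o g) (h x) 1 by case: D.
  rewrite D01E//; last by rewrite expanding_in01; exact: X01.
  rewrite derive1E derive_val hK !hX// mulrCA mulfV ?mulr1//.
  by rewrite gt_eqF// -(hX x Xx) (lt_le_trans c_gt0).
move=> _ [x Xx <-]; split; apply: D => //.
- exact: is_derive_aff0.
- by rewrite XE; left; exists x.
- exact: is_derive_aff1.
- by rewrite XE; right; exists x.
Qed.

End Conjugation.

Section Decay.
Variables (R : realType) (theta : R).
Hypotheses (theta_gt0 : 0 < theta) (theta_lt1 : theta < 1).

Lemma log_scale_ge_nat n : (0 < n)%N -> n%:R <= log_scale theta n.
Proof. by move=> n0; apply: le1r_powR; rewrite ?ler1n// invf_ge1// ltW. Qed.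

(** For n >= 1, [scale theta n] is at least e, so 2 + x <= 3 T_n <= T_n^3. Taking logarithms and the
    power theta turns log T_n into n, with 3^theta <= 3. *)
Lemma ln_powR_le_level n (x : R) : (0 < n)%N -> 0 <= x <= scale theta n ->
  ln (2 + x) `^ theta <= 3 * n%:R.
Proof.
move=> n0 /andP[x0 xn].
have L1 : 1 <= log_scale theta n.
  by apply: le_trans (log_scale_ge_nat n0); rewrite ler1n.
have H : ln (2 + x) <= 3 * log_scale theta n.
  rewrite -[leRHS]expRK ler_ln ?posrE ?expR_gt0//; last by lra.
  have -> : 3 * log_scale theta n = 2 * log_scale theta n + log_scale theta n by ring.
  rewrite expRD; have s1 := scale_ge1 theta n; rewrite /scale in xn s1.
  have e3 : 3 <= expR (2 * log_scale theta n).
    by apply: le_trans (expR_ge1Dx _); lra.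
  have : 3 * expR (log_scale theta n) <=
      expR (2 * log_scale theta n) * expR (log_scale theta n).
    by rewrite ler_wpM2r ?expR_ge0.
  lra.
apply: le_trans (_ : (3 * log_scale theta n) `^ theta <= _).
  apply: ge0_ler_powR => //; first exact: ltW.
    by rewrite nnegrE ln_ge0//; lra.
  by rewrite nnegrE; lra.
rewrite powRM//; last by lra.
rewrite /log_scale -powRrM mulVf ?gt_eqF// powRr1// ler_wpM2r//.
by apply: ler1_powR; [lra|exact: ltW].
Qed.

Lemma level_cases (x : R) : x <= scale theta 1 \/
  exists n, scale theta n.+1 <= x <= scale theta n.+2.
Proof.
have [?|x1] := leP x (scale theta 1); [by left|right].
have ex : exists n, x <= scale theta n.+2.
  exists (Num.truncn x); apply: le_trans (_ : (Num.truncn x).+2%:R <= _).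
    by apply: ltW; apply: lt_le_trans (truncnS_gt x) _; rewrite ler_nat.
  apply: le_trans (log_scale_ge_nat _) _ => //.
  by apply: le_trans (expR_ge1Dx _); rewrite lerDr.
have [n xn min_n] := ex_minnP ex.
exists n; rewrite xn andbT; case: n xn min_n => [|n] _ min_n; first exact: ltW.
by rewrite leNgt; apply/negP => /ltW/min_n; rewrite ltnn.
Qed.

(** The index i ranges over the phases, so the constants are common to all of them; y <= x separates
    the Fourier variable from the rescaled frequency. *)
Lemma stretched_decay (I : Type) (F : I -> R -> R) (C A : R) : 0 < C -> 0 <= A ->
  (forall i n x, scale theta n.+1 <= x <= scale theta n.+2 -> F i x <= C * (3 / 4) ^+ n) ->
  (forall i x, F i x <= A) ->
  exists c C', [/\ 0 < c, 0 < C' &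
    forall i x y, 0 <= y <= x -> F i x <= C' * expR (- (c * ln (2 + y) `^ theta))].
Proof.
move=> C0 A0 FC FA.
have l43 : 0 < ln (4 / 3) :> R by apply: ln_gt0; lra.
(* (3/4)^n = exp(-n ln(4/3)), and n is at least a third of the power of the logarithm. The factors 4
   cover the passage from n to n + 2, which costs 16/9, and the frequencies up to T_1, which cost
   4/3. *)
exists (ln (4 / 3) / 3), (4 * C + 4 * A); split; [by rewrite divr_gt0|lra|].
have E n y : (0 < n)%N -> 0 <= y <= scale theta n ->
    (3 / 4) ^+ n <= expR (- (ln (4 / 3) / 3 * ln (2 + y) `^ theta)).
  move=> n0 yn; have H := ln_powR_le_level n0 yn.
  have -> : (3 / 4 : R) ^+ n = expR (- (ln (4 / 3) / 3 * (3 * n%:R))).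
    rewrite (_ : _ * (3 * _) = n%:R * ln (4 / 3)); last by field.
    rewrite expRN expRM_natl lnK ?posrE ?divr_gt0//.
    by rewrite -exprVn invf_div.
  by rewrite ler_expR lerN2 ler_pM2l// divr_gt0.
move=> i x y /andP[y0 yx]; have [x1|[n /andP[n1 n2]]] := level_cases x.
  have /(E 1%N y isT) : 0 <= y <= scale theta 1 by rewrite y0 (le_trans yx).
  rewrite expr1; set e := expR _ => e34.
  have := FA i x; have : 0 <= C * e by rewrite mulr_ge0 ?expR_ge0// ltW.
  have : A * (3 / 4) <= A * e by rewrite ler_wpM2l.
  lra.
have /(E n.+2 y isT) : 0 <= y <= scale theta n.+2 by rewrite y0 (le_trans yx).
rewrite !exprS; set e := expR _; set p := _ ^+ n => pe.
have := FC i n x; rewrite n1 n2 -/p => /(_ isT).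
have : 0 <= A * e by rewrite mulr_ge0 ?expR_ge0// ltW.
have : C * (3 / 4 * (3 / 4 * p)) <= C * e by rewrite ler_pM2l.
have : 0 <= C * p by rewrite mulr_ge0 ?exprn_ge0 ?ltW//; lra.
lra.
Qed.

End Decay.

Lemma norm_complex_le (R : realType) (a b : R) :
  `|Complex a b| <= (`|a| + `|b|)%:C%C.
Proof.
rewrite normc_def lecR /= -[leRHS]ger0_norm ?addr_ge0// -sqrtr_sqr.
rewrite ler_wsqrtr// sqrrD !real_normK ?num_real//.
by rewrite lerD2r lerDl mulrn_wge0// mulr_ge0.
Qed.

(** * Choice of the constants and assembly *)

Theorem proposition10 (R : realType) (lam theta : R)
    (hlam : 0 < lam < 1 / 2) (htheta : 0 < theta < 1) :
  exists (X : set R) (mu : probability (measurableTypeR R) R),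
    [/\ is_attractor (aff0 lam) (aff1 lam) X,
        is_uniform_stationary (aff0 lam) (aff1 lam) mu &
        exists f0 f1 h : R -> R,
          [/\ pseudo_affine lam f0 f1,
              smooth_diffeo01 h,
              forall x, X x ->
                h (aff0 lam x) = f0 (h x) /\ h (aff1 lam x) = f1 (h x),
              exists2 eta : R, 0 < eta & forall x, X x -> D01 h x = eta &
              exists nu : probability (measurableTypeR R) R,
                [/\ is_uniform_stationary f0 f1 nu,
                    forall A : set (measurableTypeR R), measurable A ->
                      nu A = push01 h mu A &
                    exists c C : R,
                      [/\ 0 < c, 0 < C &
                          forall xi : R,
                            `|fourier nu xi| <=
                            (C * expR (- (c * ln (2 + `|xi|) `^ theta)))%:C%C]]]].
Proof.
have [/andP[l0 l1] /andP[t0 t1]] := (hlam, htheta).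
have [mu mu_us] := exists_cantor_measure l0 l1.
have XA := is_attractor_cantor l0 l1.
exists (cantor_attractor lam), mu; split => //.
have e0 : 0 < 1 - 2 * lam by lra.
have [B [sB B1 B0 dB0 Bbd]] := exists_bump e0.
have [C1 C1_ge0 HC1] := layer_bound t0 t1 l0 l1 Bbd 1.
have [K4 K4_gt0 HK4] := geometric_div_scale t0 t1 (ler1n R 4).
(* Two smallness conditions at once: delta C1 <= 1/8 puts G' in [3/4, 5/4], and delta K4 <= 1 gives
   amplitudes below 2^-n. *)
pose delta := (8 * (C1 + 1) + K4)^-1.
have D0 : 0 < 8 * (C1 + 1) + K4 by lra.
have d0 : 0 < delta by rewrite invr_gt0.
have dD : delta * (8 * (C1 + 1) + K4) = 1 by rewrite mulVf ?gt_eqF.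
have dC : delta * C1 <= 1 / 8 by rewrite mulrC ler_pdivrMr//; lra.
have amp n : amplitude theta delta n <= 2^-1 ^+ n.
  rewrite /amplitude -mulrA; apply: le_trans (ler_wpM2l (ltW d0) (HK4 n)) _.
  rewrite mulrA ler_piMl ?exprn_ge0//.
  by rewrite mulrC ler_pdivrMr//; lra.
have [q [q01 [Cq Cq0 qP]]] := exists_perturbation t0 l0 l1 d0 amp.
pose G := perturbed theta lam B delta q.
have sG : smooth G by exact: smooth_perturbed.
have dG x : 3 / 4 <= derive1 G x <= 5 / 4.
  by apply: derive1_perturbed_close dC x => // y; exact: HC1.
have dGx (x : R) : is_derive x 1 G (derive1 G x).
  by apply: derivable_is_derive; case: (sG 1%N).
have [z _ zE] := MVT_between 0 1 dGx; rewrite subr0 mulr1 in zE.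
(* The affine normalization fixing 0 and 1; as G' = 1 on the attractor, eta is also the value of h'
   there. *)
pose eta := (G 1 - G 0)^-1.
have /andP[z1 z2] := dG z; rewrite -zE in z1 z2.
have G10 : 0 < G 1 - G 0 by lra.
have eta0 : 0 < eta by rewrite invr_gt0.
pose h x := eta * G x + - (eta * G 0).
have sh : smooth h.
  by move=> n; apply: CkD; [apply: CkM; [exact: Ck_cst|exact: sG]|exact: Ck_cst].
have dh : derive1 h = (fun x => eta * derive1 G x).
  apply: derive1_funE => x.
  exact: (@is_derive1_comp _ (fun y => eta * y + - (eta * G 0)) G x _ _
    (is_derive_affine _ _ _) (dGx x)).
have hc x : eta * (3 / 4) <= derive1 h x.
  by rewrite dh ler_pM2l//; case/andP: (dG x).
have c0 : 0 < eta * (3 / 4) by rewrite mulr_gt0//; lra.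
have h0 : h 0 = 0 by rewrite /h subrr.
have h1 : h 1 = 1 by rewrite /h -mulrBr mulVf ?gt_eqF.
have hX x : cantor_attractor lam x -> derive1 h x = eta.
  by move=> Xx; rewrite dh /G derive1_perturbed_attractor ?mulr1.
have [g [hK gK]] := expanding_inverse sh c0 hc.
have dist x y : derive1 h x <= 2 * derive1 h y.
  rewrite dh mulrCA ler_pM2l//.
  (* The quotient of two values of G' is at most (5/4)/(3/4) = 5/3. *)
  have /andP[_ a] := dG x; have /andP[b _] := dG y.
  by apply: le_trans a _; move: (derive1 G y) b => d b; clear -b; lra.
have ch := smooth_continuous sh.
have cg := smooth_continuous (smooth_inverse sh c0 hc hK gK).
have h01 := expanding_in01 sh c0 hc h0 h1.
have [mu01 _] := mu_us.1.
exists (h \o aff0 lam \o g), (h \o aff1 lam \o g), h; split.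
- exact: (pseudo_affine_conj l0 l1 sh c0 hc hK gK h0 h1 dist hX).
- exact: (smooth_diffeo01_expanding sh c0 hc hK gK h0 h1).
- by move=> x _; rewrite /= hK.
- exists eta => // x Xx; rewrite D01E; [exact: hX|exact: (Xx 0%N I)|].
  by case: (sh 1%N).
have [nu nuE] := exists_pushforward mu ch.
exists nu; split.
- exact: (is_uniform_stationary_conj hK gK ch cg (@continuous_aff0 _ lam)
    (@continuous_aff1 _ lam) h01 nuE mu_us).
- move=> A mA; rewrite /push01 prob_setI_full ?nuE//.
  exact: measurable_preimageR.
have [K K0 HK] := perturbed_partial_error t0 t1 l0 l1 Bbd d0 q01.
(* K accounts for the tail of the series, and the added 1 for the variation lam^m <= 2^-m of the
   truncation inside a cylinder. *)
have Gcyl m k x : (k < 2 ^ m)%N -> 0 <= x <= 1 ->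
    `|G (cylinder_left lam m k + lam ^+ m * x) - height theta lam delta q m k|
      <= (K + 1) * 2^-1 ^+ m.
  move=> km x01; have := HK m (cylinder_left lam m k + lam ^+ m * x).
  rewrite (partial_perturbed_on_cylinder theta l0 l1 B1 B0 delta q km x01) -/G => H.
  have lx : 0 <= lam ^+ m * x <= 2^-1 ^+ m.
    have /andP[x0 x1] := x01; have lm : 0 <= lam ^+ m by rewrite exprn_ge0// ltW.
    rewrite mulr_ge0//=; apply: le_trans (_ : lam ^+ m <= _).
      by rewrite ler_piMr.
    by rewrite lerXn2r ?nnegrE//; lra.
  by move: H lx => /[!ler_norml] /andP[a b] /andP[a' b']; apply/andP; split; lra.
pose I w phi := Rintegral mu setT (fun x => cos (w * G x + phi)).
have IP n w phi : scale theta n.+1 <= w <= scale theta n.+2 ->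
    `|I w phi| <= Cq * (3 / 4) ^+ n.
  move=> wn; apply: (@Rintegral_phase_bound _ _ _ mu_us.1 q theta delta G _
    (smooth_continuous sG) Gcyl w phi _ n).
    by case/andP: wn => + _; apply: le_trans; exact: ltW (scale_gt0 _ _).
  by move=> j nj; exact: (qP n j w phi nj wn).
have I1 w phi : `|I w phi| <= 1.
  have cf := @continuous_cos_phase R G w phi (smooth_continuous sG).
  rewrite -[I w phi]subr0.
  apply: (Rintegral_close mu_us.1 cf (fun x => cos_max _)) => x _.
  by rewrite subr0 cos_max.
(* The sign of xi is absorbed by the evenness of cos, and the additive constant of h goes into the
   phase; a nonnegative frequency 2 pi eta |xi| for G remains. *)
have fourierE xi psi : exists phi,
    Rintegral nu setT (fun t => cos (- (2 * pi * xi * t) + psi)) =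
    I (2 * pi * eta * `|xi|) phi.
  pose s : R := if 0 <= xi then 1 else -1.
  have xiE : xi = s * `|xi|.
    rewrite /s; case: (leP 0 xi) => xi0; first by rewrite ger0_norm// mul1r.
    by rewrite ltr0_norm// mulrNN mul1r.
  have ss : s * s = 1 by rewrite /s; case: ifP => _; rewrite ?mulrNN mul1r.
  have cs x y : cos (x + y) = cos (- s * x + - s * y).
    by rewrite /s; case: ifP => _; rewrite ?opprK ?mul1r// !mulN1r -opprD cosN.
  exists (- (2 * pi * eta * `|xi|) * G 0 - s * psi).
  have ck : continuous (fun t => cos (- (2 * pi * xi * t) + psi)).
    have := @continuous_cos_phase R id (- (2 * pi * xi)) psi.
    by under [X in _ -> continuous X]eq_fun do rewrite -mulNr; apply => x; exact: cvg_id.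
  rewrite (Rintegral_pushforward ch ck (fun x => cos_max _) nuE).
  congr Rintegral; apply/funext => x /=; rewrite cs; congr cos.
  have -> : - s * - (2 * pi * xi * h x) = s * xi * (2 * pi * h x) by ring.
  have -> : s * xi = `|xi| by rewrite [in LHS]xiE mulrA ss mul1r.
  by rewrite /h; ring.
pose F phi w := `|I w phi|.
have [c [C [c_gt0 C_gt0 FP]]] := stretched_decay t0 t1 Cq0 ler01
  (fun phi n w wn => IP n w phi wn : F phi w <= _) (fun phi w => I1 w phi : F phi w <= 1).
exists c, (2 * C); split; [by []|by rewrite mulr_gt0|] => xi.
apply: le_trans (norm_complex_le _ _) _; rewrite lecR.
(* G 1 - G 0 <= 5/4 gives eta >= 1/2, so 2 pi eta >= 1 and the rescaled frequency dominates |xi|. *)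
have w_ge : 0 <= `|xi| <= 2 * pi * eta * `|xi|.
  have eta1 : 1 <= eta * 2 by rewrite mulrC ler_pdivlMr//; lra.
  have p2 := pi_ge2 R; rewrite normr_ge0/= -[X in X <= _]mul1r ler_wpM2r//.
  by have := ler_wpM2l (ltW eta0) p2; lra.
have bound psi : `|Rintegral nu setT (fun t => cos (- (2 * pi * xi * t) + psi))| <=
    C * expR (- (c * ln (2 + `|xi|) `^ theta)).
  by have [phi ->] := fourierE xi psi; exact: FP phi _ _ w_ge.
have cosE : (fun t => cos (- (2 * pi * xi * t))) =
    (fun t => cos (- (2 * pi * xi * t) + 0)) by apply/funext => t; rewrite addr0.
(* The imaginary part is the cosine integral at phase -pi / 2; the real and imaginary parts obey the
   same bound, whence the factor 2. *)
have sinE : (fun t => sin (- (2 * pi * xi * t))) =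
    (fun t => cos (- (2 * pi * xi * t) + - (pi / 2))).
  apply/funext => t; rewrite cosB cos_pihalf sin_pihalf; ring.
rewrite cosE sinE (_ : 2 * C * _ = C * expR (- (c * ln (2 + `|xi|) `^ theta)) +
  C * expR (- (c * ln (2 + `|xi|) `^ theta))); last by ring.
by apply: lerD; exact: bound.
Qed.
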